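(* There exists a term $F(x,y)$ of $\mathcal M$ such that the problem ''solution of the equation $F(x,a)=0$ in $x$'' is NP-complete.
   Context: $\mathcal M$ is the first-order language with equality with constant symbols $\mathbf 0,\mathbf 1,-\mathbf 1,\mathbf n$, unary function symbols $\mathcal N,\mathbf p$, and binary function symbols $+,\times,\div,\max,\min,\cap$. For $d\in\omega$ and $n=2^d$, $\mathbf M_d$ has universe $\{0,\dots,2^n-1\}$; $+,\times$ are modulo $2^n$; $\mathbf p(x)=\min\{2^x,2^n-1\}$; $\div(x,y)=\lfloor x/y\rfloor$ for $y\neq0$ and $0$ for $y=0$; constants denote $0,1,n,2^n-1$; $\max,\min$ usual; $\cap$ bitwise AND and $\mathcal N$ bitwise complement on $n$-bit binary representations. For a term $F(x,y)$, the problem ''solution of the equation $F(x,a)=0$ in $x$'' is the following NP problem: an instance of size $n=2^d$ is an integer $a\in\{0,\dots,2^n-1\}$, and an integer $b\in\{0,\dots,2^n-1\}$ is a solution if $\mathbf M_d\models F(b,a)=\mathbf 0$; the question is whether a solution exists. *)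

(* Defs.v *)
From HB Require Import structures.
From mathcomp Require Import all_boot all_order all_algebra.

Set Implicit Arguments.
Unset Strict Implicit.
Unset Printing Implicit Defensive.

(* Deterministic multi-tape Turing machines with two-way infinite tapes.      *)
(* The tape alphabet is [option (bool + aux)]: [None] is the blank and        *)
(* [Some (inl b)] is the input/output bit [b].                                *)

Inductive move := MoveLeft | MoveRight | Stay.

Record machine := Machine {
  tapes : nat; (* the number of tapes, minus one *)
  state : finType;
  aux : finType;
  start : state;
  halting : pred state;
  trans : state -> {ffun 'I_tapes.+1 -> option (bool + aux)} ->
          state * ('I_tapes.+1 -> option (bool + aux) * move)
}.

Definition symbol (M : machine) : Type := option (bool + aux M).

(* [(l, r)] is the tape ... l_1 l_0 r_0 r_1 ... with the head on r_0; all the *)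
(* cells that are not listed are blank.                                       *)
Definition tape (M : machine) : Type := (seq (symbol M) * seq (symbol M))%type.

Definition tape_read M (t : tape M) : symbol M := head None t.2.

Definition tape_update M (t : tape M) (a : symbol M * move) : tape M :=
  let: (l, r) := t in
  match a.2 with
  | MoveLeft => (behead l, head None l :: a.1 :: behead r)
  | MoveRight => (a.1 :: l, behead r)
  | Stay => (l, a.1 :: behead r)
  end.

Definition config (M : machine) : Type :=
  (state M * ('I_(tapes M).+1 -> tape M))%type.

Definition step M (c : config M) : config M :=
  if halting c.1 then c else
  let: (q, act) := trans c.1 [ffun i => tape_read (c.2 i)] in
  (q, fun i => tape_update (c.2 i) (act i)).

(* The i-th input is written on the i-th tape, with the head on its first bit. *)
Definition init M (xs : seq (seq bool)) : config M :=
  (start M, fun i : 'I_(tapes M).+1 => ([::], [seq Some (inl b) | b <- nth [::] xs i])).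

Fixpoint bits_prefix (A : Type) (s : seq (option (bool + A))) : seq bool :=
  if s is Some (inl b) :: s' then b :: bits_prefix s' else [::].

(* The output is the maximal string of bits that starts at the head of tape 0. *)
Definition output M (c : config M) : seq bool := bits_prefix (c.2 ord0).2.

(* A halted configuration is a fixed point of [step], so this says that [M]   *)
(* halts within [t] steps.                                                    *)
Definition outputs_in M (xs : seq (seq bool)) (t : nat) (y : seq bool) : Prop :=
  let c := iter t (@step M) (init M xs) in halting c.1 /\ output c = y.

Definition polytime_fun (f : seq bool -> seq bool) : Prop :=
  exists (M : machine) (p : {poly nat}),
    forall x, outputs_in M [:: x] p.[size x]%R (f x).

Definition polytime_rel (R : seq bool -> seq bool -> bool) : Prop :=
  exists (M : machine) (p : {poly nat}),
    forall x y, outputs_in M [:: x; y] p.[(size x + size y)%N]%R [:: R x y].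

Definition language : Type := seq bool -> Prop.

Definition NP (L : language) : Prop :=
  exists (R : seq bool -> seq bool -> bool) (q : {poly nat}),
    polytime_rel R /\
    forall x, L x <-> exists y, size y <= q.[size x]%R /\ R x y.

Definition polytime_reducible (L1 L2 : language) : Prop :=
  exists f, polytime_fun f /\ forall x, L1 x <-> L2 (f x).

Definition NP_hard (L : language) : Prop :=
  forall L', NP L' -> polytime_reducible L' L.

Definition NP_complete (L : language) : Prop := NP L /\ NP_hard L.

(* Terms of the language M whose variables are among v_0, ..., v_(k-1). *)
Inductive term (k : nat) : Type :=
| Var of 'I_k
| Zero
| One
| MinusOne
| Size
| Compl of term k
| Pow of term k
| Add of term k & term k
| Mul of term k & term k
| Div of term k & term k
| Max of term k & term k
| Min of term k & term k
| Cap of term k & term k.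

Arguments Zero {k}.
Arguments One {k}.
Arguments MinusOne {k}.
Arguments Size {k}.

Definition bit (x i : nat) : bool := odd (x %/ 2 ^ i).

Definition of_bits (n : nat) (f : nat -> bool) : nat := \sum_(i < n) f i * 2 ^ i.

Definition wordsize (d : nat) : nat := 2 ^ d.

Definition univ (d : nat) : Type := 'I_(2 ^ wordsize d).

Lemma univ_gt0 d : 0 < 2 ^ wordsize d.
Proof. by rewrite expn_gt0. Qed.

Definition to_univ d (x : nat) : univ d := Ordinal (ltn_pmod x (univ_gt0 d)).

(* The reduction modulo 2^n in [to_univ] is effective only for [Add] and      *)
(* [Mul]; the other values are already below 2^n. [x %/ 0] is [0].            *)
Fixpoint eval d k (v : k.-tuple (univ d)) (t : term k) : univ d :=
  let n := wordsize d in
  let ev := eval v in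
  match t with
  | Var i => tnth v i
  | Zero => to_univ d 0
  | One => to_univ d 1
  | MinusOne => to_univ d (2 ^ n - 1)
  | Size => to_univ d n
  | Compl s => to_univ d (of_bits n (fun i => ~~ bit (ev s) i))
  | Pow s => to_univ d (minn (2 ^ ev s) (2 ^ n - 1))
  | Add s t => to_univ d (ev s + ev t)
  | Mul s t => to_univ d (ev s * ev t)
  | Div s t => to_univ d (ev s %/ ev t)
  | Max s t => to_univ d (maxn (ev s) (ev t))
  | Min s t => to_univ d (minn (ev s) (ev t))
  | Cap s t => to_univ d (of_bits n (fun i => bit (ev s) i && bit (ev t) i))
  end.

(* [b] solves F(x, a) = 0; the variables x, y of F(x, y) are v_0, v_1. *)
Definition is_solution (F : term 2) d (a b : univ d) : Prop :=
  eval [tuple b; a] F = eval [tuple b; a] Zero.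

(* The instance [a] of size n = 2^d is presented to a machine as its n-bit    *)
(* binary representation, least significant bit first; d is recovered from    *)
(* the length n, and a string whose length is not a power of 2 is no instance. *)
Definition encode d (a : univ d) : seq bool := mkseq (bit a) (wordsize d).

Definition solution_problem (F : term 2) : language := fun w =>
  exists (d : nat) (a : univ d),
    w = encode a /\ exists b : univ d, is_solution F a b.

(* Main.v *)
Require Import Defs.
From mathcomp Require Import all_boot all_order all_algebra.
From mathcomp Require Import zify.
From Stdlib Require Import FunctionalExtensionality.

(* For n = w^2 the word [a] is read as a w x w bit matrix, one clause per row, *)
(* and the equation asks for a set u of columns, no two of them adjacent, that *)
(* meets every row. Multiplying u by the repunit (2^n - 1) / (2^w - 1) copies  *)
(* it into every row, and a carry into the top bit of a row detects that the   *)
(* row is met. As adjacent columns can stand for complementary literals, this  *)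
(* is satisfiability.                                                          *)
(*                                                                             *)
(* Hardness: the clauses describe a run of the verifier, with all tapes shifted *)
(* so that the heads never move. They are Horn implications from facts at time  *)
(* t to facts at time t + 1, so a satisfying assignment contains all the true   *)
(* facts of the run on the certificate that it guesses in the first row.        *)
(*                                                                             *)
(* Both the verifier of the equation and the reduction are given by arithmetic *)
(* expressions with bounded sums over the inputs; evaluating such expressions  *)
(* in unary, on a machine whose tapes are used as stacks, takes polynomial time. *)

(** A word of n = w^2 bits is a w x w matrix, and a fixed number of word operations can test all its
    rows at once: multiplication by a repunit copies a pattern into every row, and an addition whose
    carries stay inside the rows detects the non-zero ones. A term can therefore demand a set u of
    columns, no two adjacent, that meets every row of a. The side w is not computed from n; it is
    guessed as part of x and checked by w^2 = n. [Fterm_solution] proves this meaning of [Fterm],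
    and [solution_problemP] transfers it to strings.

    Membership in NP follows with u as the certificate. For hardness, fix a verifier with time T and
    certificate length Q, and take a boolean variable for each fact: at time t the state is q, or
    cell i of tape k contains s. The clauses say that the initial facts are right, with a free
    choice of the certificate, that true facts propagate by the transition function, and that facts
    contradicting acceptance are false. Nothing forbids extra true facts. An accepting run satisfies
    the clauses ([run_satisfies]); conversely, by induction on time, an assignment makes every fact
    of the run in the relevant cells true, so the run cannot end in an error ([satisfies_run]).
    Literals become columns, the two literals of a fact being adjacent, and clauses become rows
    ([selects_satisfies], [satisfies_selects]), which yields [reduction_correct].

    For polynomial time, expressions with bounded sums are compiled to stack programs
    ([compile_runs]) and these to Turing machines ([exec_outputs]). Hence [polytime_rel_value] and
    [polytime_fun_value] reduce both time bounds to closure properties of [definable]. *)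

Set Implicit Arguments.
Unset Strict Implicit.
Unset Printing Implicit Defensive.

(** * Stack programs *)

Inductive cmd :=
| Push of nat & bool
| Pop of nat
| Seq of cmd & cmd
| If of nat & cmd & cmd
| While of nat & cmd.

Definition store := nat -> seq bool.

Definition upd (s : store) k v : store := fun j => if j == k then v else s j.

(** The last argument is the exact number of steps of the compiled machine, as [exec_reach] shows.
    An empty stack counts as false in [If]. *)
Inductive exec : cmd -> store -> store -> nat -> Prop :=
| ExecPush k b s : exec (Push k b) s (upd s k (b :: s k)) 2
| ExecPop k s : exec (Pop k) s (upd s k (behead (s k))) 1
| ExecSeq a b s1 s2 s3 t1 t2 :
    exec a s1 s2 t1 -> exec b s2 s3 t2 -> exec (Seq a b) s1 s3 (t1 + t2)
| ExecIfT k a b s s' t :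
    head false (s k) -> exec a s s' t -> exec (If k a b) s s' t.+1
| ExecIfF k a b s s' t :
    ~~ head false (s k) -> exec b s s' t -> exec (If k a b) s s' t.+1
| ExecWhileEnd k a s : s k = [::] -> exec (While k a) s s 1
| ExecWhile k a s1 s2 s3 t1 t2 :
    s1 k <> [::] -> exec a s1 s2 t1 -> exec (While k a) s2 s3 t2 ->
    exec (While k a) s1 s3 (t1 + t2).+1.

Notation sym := (option (bool + void)).
Notation rtape := (seq sym * seq sym)%type.

(** The control states inside a command: a push has one for each of its two machine steps, and
    [None] is the test of an [If] or the head of a [While]. *)
Fixpoint point (c : cmd) : finType :=
  match c with
  | Push _ _ => bool
  | Pop _ => unit
  | Seq a b => (point a + point b)%type
  | If _ a b => option (point a + point b)
  | While _ a => option (point a)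
  end.

Fixpoint entry (c : cmd) : point c :=
  match c with
  | Push _ _ => false
  | Pop _ => tt
  | Seq a b => inl (entry a)
  | If _ a b => None
  | While _ a => None
  end.

Definition action := option (nat * (sym * move)).

(* The target [None] is the exit of the command. A push takes two steps, *)
(* since a machine writes before it moves.                               *)
Fixpoint delta (c : cmd) : point c -> (nat -> sym) -> option (point c) * action :=
  match c with
  | Push k b => fun l rd =>
      if l then (None, Some (k, (Some (inl b), Stay)))
      else (Some true, Some (k, (rd k, MoveLeft)))
  | Pop k => fun _ rd => (None, Some (k, (None, MoveRight)))
  | Seq a b => fun l rd =>
      match l with
      | inl l => let: (o, m) := @delta a l rd in
                 (Some (if o is Some l' then inl l' else inr (entry b)), m)
      | inr l => let: (o, m) := @delta b l rd in (omap inr o, m)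
      end
  | If k a b => fun l rd =>
      match l with
      | None => (Some (Some (if rd k is Some (inl true) then inl (entry a)
                             else inr (entry b))), None)
      | Some (inl l) => let: (o, m) := @delta a l rd in (omap (fun l => Some (inl l)) o, m)
      | Some (inr l) => let: (o, m) := @delta b l rd in (omap (fun l => Some (inr l)) o, m)
      end
  | While k a => fun l rd =>
      match l with
      | None => (if rd k is None then None else Some (Some (entry a)), None)
      | Some l => let: (o, m) := @delta a l rd in (Some o, m)
      end
  end.

(** * Simulation of stack programs by Turing machines *)

Section Simulation.

Variable K : nat.

Definition tape_step (t : rtape) (a : sym * move) : rtape :=
  let: (l, r) := t in
  match a.2 with
  | MoveLeft => (behead l, head None l :: a.1 :: behead r)
  | MoveRight => (a.1 :: l, behead r)
  | Stay => (l, a.1 :: behead r)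
  end.

Definition action_on (a : action) (rd : sym) (i : nat) : sym * move :=
  if a is Some (k, sm) then if i == k then sm else (rd, Stay) else (rd, Stay).

Definition act (T : 'I_K.+1 -> rtape) (a : action) : 'I_K.+1 -> rtape :=
  fun i => tape_step (T i) (action_on a (head None (T i).2) i).

Definition reads (T : 'I_K.+1 -> rtape) (k : nat) : sym := head None (T (inord k)).2.

(** Runs that end at the exit of [c], so that the run of a subcommand can be spliced into the run of
    the enclosing command. *)
Inductive reach c : point c -> ('I_K.+1 -> rtape) -> nat -> ('I_K.+1 -> rtape) -> Prop :=
| ReachExit l T m : delta l (reads T) = (None, m) -> reach l T 1 (act T m)
| ReachStep l T m l' t T' : delta l (reads T) = (Some l', m) ->
    reach l' (act T m) t T' -> reach l T t.+1 T'.

Lemma reach_seql a b l T t T' t2 T2 : @reach a l T t T' ->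
  @reach b (entry b) T' t2 T2 -> @reach (Seq a b) (inl l) T (t + t2) T2.
Proof.
elim=> {l T t T'} [l T m E|l T m l' t T' E _ IH] R2.
  apply: (@ReachStep (Seq a b) _ _ m (inr (entry b))); first by rewrite /= E.
  by elim: R2 => [l1 T1 m1 E1|l1 T1 m1 l' t1 T1' E1 _ IH];
    [apply: ReachExit|apply: ReachStep IH]; rewrite /= E1.
by apply: (@ReachStep (Seq a b) _ _ m (inl l')); rewrite /= ?E //; apply: IH.
Qed.

Lemma reach_ifl k a b l T t T' : @reach a l T t T' ->
  @reach (If k a b) (Some (inl l)) T t T'.
Proof.
by elim=> {l T t T'} [l T m E|l T m l' t T' E _ IH]; [apply: ReachExit|apply: ReachStep IH];
  rewrite /= E.
Qed.

Lemma reach_ifr k a b l T t T' : @reach b l T t T' ->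
  @reach (If k a b) (Some (inr l)) T t T'.
Proof.
by elim=> {l T t T'} [l T m E|l T m l' t T' E _ IH]; [apply: ReachExit|apply: ReachStep IH];
  rewrite /= E.
Qed.

Lemma reach_while k a l T t T' t2 T2 : @reach a l T t T' ->
  @reach (While k a) None T' t2 T2 -> @reach (While k a) (Some l) T (t + t2) T2.
Proof.
elim=> {l T t T'} [l T m E|l T m l' t T' E _ IH] R2.
  by apply: (@ReachStep (While k a) _ _ m None); rewrite /= ?E.
by apply: (@ReachStep (While k a) _ _ m (Some l')); rewrite /= ?E //; apply: IH.
Qed.

Fixpoint within (c : cmd) : bool :=
  match c with
  | Push k _ | Pop k => k <= K
  | Seq a b => within a && within b
  | If k a b => [&& k <= K, within a & within b]
  | While k a => (k <= K) && within a
  end.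

(* Unlisted cells and listed blanks are not distinguished. *)
Definition represents (T : 'I_K.+1 -> rtape) (s : store) : Prop :=
  forall i j, nth None (T i).1 j = None /\
              nth None (T i).2 j = nth None [seq Some (inl b) | b <- s i] j.

Lemma represents_reads T s k : represents T s -> k <= K ->
  reads T k = nth None [seq Some (inl b) | b <- s k] 0.
Proof.
move=> R kK; have [_] := R (inord k) 0; rewrite inordK // => <-.
Qed.

Lemma tape_step_stay (t : rtape) j :
  nth None (tape_step t (head None t.2, Stay)).1 j = nth None t.1 j /\
  nth None (tape_step t (head None t.2, Stay)).2 j = nth None t.2 j.
Proof. by case: t => l [|a r] //=; split=> //; case: j => [|[|j]]. Qed.

Lemma represents_idle T s : represents T s -> represents (act T None) s.
Proof.
by move=> R i j; rewrite /act /action_on; have [-> ->] := tape_step_stay (T i) j.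
Qed.

(** A pop erases the cell before moving right, so everything to the left of the head stays blank and
    the head stays on the top of the stack. *)
Lemma represents_pop T s k : represents T s ->
  represents (act T (Some (k, (None, MoveRight)))) (upd s k (behead (s k))).
Proof.
move=> R i j; rewrite /act /action_on /upd; case: eqP => [ik|_].
  have [R1 _] := R i j.-1; have [_ R2] := R i j.+1.
  case: (T i) R1 R2 => l r /= R1 R2; split; first by case: j R1 {R2}.
  by rewrite nth_behead R2 -ik; case: (s i) => [|a q] //=; rewrite nth_nil.
by have [-> ->] := tape_step_stay (T i) j.
Qed.

Lemma represents_push T s k b : represents T s -> k <= K ->
  represents (act (act T (Some (k, (reads T k, MoveLeft)))) (Some (k, (Some (inl b), Stay))))
    (upd s k (b :: s k)).
Proof.
move=> R kK i j; rewrite /act /action_on /upd; case: eqP => [ik|_].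
  have E : reads T k = head None (T i).2 by rewrite /reads -ik inord_val.
  rewrite E; have [R1 _] := R i j.+1; have [_ R2] := R i j.-1.
  case: (T i) R1 R2 => l r /=; rewrite -nth_behead => -> R2; split=> //.
  by case: j R2 => //= j; rewrite -ik => <-; case: r {E} => [|a r] //; case: j => [|[|j]].
have [-> ->] := tape_step_stay (tape_step (T i) (head None (T i).2, Stay)) j.
by have [-> ->] := tape_step_stay (T i) j.
Qed.

Lemma exec_reach c s s' t : exec c s s' t -> within c ->
  forall T, represents T s ->
  exists2 T', reach (entry c) T t T' & represents T' s'.
Proof.
elim=> {c s s' t} /=.
- move=> k b s kK T R; eexists; last exact: represents_push R kK.
  by apply: ReachStep; [reflexivity|apply: ReachExit].
- move=> k s kK T R; eexists; last exact: represents_pop R.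
  exact: ReachExit.
- move=> a b s1 s2 s3 t1 t2 _ IH1 _ IH2 /andP[wa wb] T R.
  have [T1 RT1 R1] := IH1 wa T R; have [T2 RT2 R2] := IH2 wb T1 R1.
  by exists T2 => //; apply: reach_seql RT1 RT2.
- move=> k a b s s' t h _ IH /and3P[kK wa wb] T R.
  have [T1 RT1 R1] := IH wa _ (represents_idle R); exists T1 => //.
  apply: (@ReachStep (If k a b) _ _ None (Some (inl (entry a)))).
    by rewrite /= (represents_reads R kK); case: (s k) h => [|[] q].
  exact: reach_ifl.
- move=> k a b s s' t h _ IH /and3P[kK wa wb] T R.
  have [T1 RT1 R1] := IH wb _ (represents_idle R); exists T1 => //.
  apply: (@ReachStep (If k a b) _ _ None (Some (inr (entry b)))).
    by rewrite /= (represents_reads R kK); case: (s k) h => [|[] q].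
  exact: reach_ifr.
- move=> k a s h /andP[kK wa] T R; exists (act T None); last exact: represents_idle.
  by apply: ReachExit; rewrite /= (represents_reads R kK) h.
move=> k a s1 s2 s3 t1 t2 h _ IH1 _ IH2 w T R; have /andP[kK wa] := w.
have [T1 RT1 R1] := IH1 wa _ (represents_idle R).
have [T2 RT2 R2] := IH2 w _ R1; exists T2 => //.
apply: (@ReachStep (While k a) _ _ None (Some (entry a))).
  by rewrite /= (represents_reads R kK); case: (s1 k) h.
exact: reach_while RT1 RT2.
Qed.

Definition compiled (c : cmd) : machine :=
  @Machine K (option (point c)) void (Some (entry c)) (fun q => q == None)
    (fun q rds =>
       if q is Some l then
         let: (o, m) := delta l (fun k => rds (inord k)) in
         (o, fun i => action_on m (rds i) i)
       else (None, fun i => (rds i, Stay))).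

Lemma compiled_step c l T o m : @delta c l (reads T) = (o, m) ->
  @step (compiled c) (Some l, T) = (o, act T m).
Proof.
move=> E; rewrite /step /=.
have -> : (fun k => [ffun i => tape_read (M := compiled c) (T i)] (inord k)) = reads T.
  by apply: functional_extensionality => k; rewrite ffunE.
rewrite E; congr pair; apply: functional_extensionality => i.
by rewrite ffunE /act /tape_read; case: (T i).
Qed.

Lemma reach_iter c l T t T' : @reach c l T t T' ->
  iter t (@step (compiled c)) (Some l, T) = (None, T').
Proof.
elim=> {l T t T'} [l T m E|l T m l' t T' E _ IH].
  by rewrite /= (compiled_step E).
by rewrite iterSr (compiled_step E).
Qed.

Lemma bits_prefix_represents (r : seq sym) s :
  (forall j, nth None r j = nth None [seq Some (inl b) | b <- s] j) -> bits_prefix r = s.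
Proof.
elim: s r => [|b s IH] [|a r] H //=.
- by have /= := H 0 => ->.
- by have := H 0.
by have /= := H 0 => ->; congr cons; apply: IH => j; apply: (H j.+1).
Qed.

Lemma iter_halted (M : machine) t t' (c : config M) :
  halting (iter t (@step M) c).1 -> t <= t' ->
  iter t' (@step M) c = iter t (@step M) c.
Proof.
move=> h le; rewrite -(subnK le) iterD.
by elim: (t' - t) => //= k ->; rewrite /step h.
Qed.

Lemma exec_outputs c xs s' t t' : exec c (fun j => nth [::] xs j) s' t -> within c ->
  t <= t' -> outputs_in (compiled c) xs t' (s' 0).
Proof.
move=> E w le.
have R : represents (init (compiled c) xs).2 (fun j => nth [::] xs j).
  by move=> i j /=; rewrite nth_nil.
have [T' /reach_iter RT R'] := exec_reach E w R.
rewrite /outputs_in.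
have -> : iter t' (@step (compiled c)) (init (compiled c) xs) = (None, T').
  by rewrite (@iter_halted _ t) //; rewrite [init _ _]/= RT.
split=> //; rewrite /output /=; apply: bits_prefix_represents => j.
by have [] := R' ord0 j.
Qed.

End Simulation.

(** * Running times of basic stack programs *)

Lemma upd_eq s k v : upd s k v k = v.
Proof. by rewrite /upd eqxx. Qed.

Lemma upd_neq s k v j : j != k -> upd s k v j = s j.
Proof. by rewrite /upd => /negbTE ->. Qed.

Definition runs c s s' B := exists2 t, exec c s s' t & t <= B.

Lemma runs_push k b s B : 2 <= B -> runs (Push k b) s (upd s k (b :: s k)) B.
Proof. by exists 2 => //; apply: ExecPush. Qed.

Lemma runs_pop k s B : 1 <= B -> runs (Pop k) s (upd s k (behead (s k))) B.
Proof. by exists 1 => //; apply: ExecPop. Qed.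

Lemma runs_seq a b s1 s2 s3 B1 B2 B : runs a s1 s2 B1 -> runs b s2 s3 B2 ->
  B1 + B2 <= B -> runs (Seq a b) s1 s3 B.
Proof.
move=> [t1 E1 l1] [t2 E2 l2] l; exists (t1 + t2); first exact: ExecSeq E1 E2.
exact: leq_trans (leq_add l1 l2) l.
Qed.

Lemma runs_if k a b s s' B B' :
  (if head false (s k) then runs a s s' B else runs b s s' B) -> B < B' ->
  runs (If k a b) s s' B'.
Proof.
case: ifP => h [t E l] l'; exists t.+1.
- exact: ExecIfT.
- exact: leq_ltn_trans l l'.
- by apply: ExecIfF => //; rewrite h.
exact: leq_ltn_trans l l'.
Qed.

Lemma runs_while k a (I : nat -> store) n B B' s s' :
  s = I 0 -> s' = I n ->
  (forall i, i < n -> I i k <> [::] /\ runs a (I i) (I i.+1) B) -> I n k = [::] ->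
  n * B.+1 < B' -> runs (While k a) s s' B'.
Proof.
move=> -> -> H E l; suff [t Et lt] : exists2 t, exec (While k a) (I 0) (I n) t & t <= (n * B.+1).+1.
  by exists t => //; apply: leq_trans lt l.
elim: n I H E {l} => [|n IH] I H E; first by exists 1 => //; apply: ExecWhileEnd.
have [h [t1 E1 l1]] := H 0 isT.
have [t2 E2 l2] := IH (fun i => I i.+1) (fun i => H i.+1) E.
by exists (t1 + t2).+1; [apply: ExecWhile E1 E2|nia].
Qed.

Ltac store_with T :=
  apply: functional_extensionality => ?; rewrite /upd;
  repeat (case: eqP => ?); subst; try lia; T.
Ltac store_eq := store_with ltac:(try done).

Definition transfer a b := While a (Seq (If a (Push b true) (Push b false)) (Pop a)).

Lemma runs_transfer a b s B : a != b -> 5 * size (s a) < B ->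
  runs (transfer a b) s (upd (upd s a [::]) b (rev (s a) ++ s b)) B.
Proof.
move=> /eqP ab lB.
pose I i := upd (upd s a (drop i (s a))) b (rev (take i (s a)) ++ s b).
apply: (@runs_while _ _ I (size (s a)) 4).
- rewrite /I take0 drop0 /=; store_eq.
- rewrite /I take_size drop_size /=; store_eq.
- move=> i li; have E : I i a = drop i (s a).
    by rewrite /I /upd; case: eqP => //; rewrite eqxx.
  rewrite E (drop_nth false li); split=> //.
  apply: (@runs_seq _ _ _ (upd (I i) b (nth false (s a) i :: I i b)) _ 3 1) => //.
    apply: (@runs_if _ _ _ _ _ 2) => //.
    by rewrite E (drop_nth false li) /=; case: nth; apply: runs_push.
  set s' := upd _ b _; have -> : I i.+1 = upd s' a (behead (s' a)); last exact: runs_pop.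
  rewrite /s' /I (take_nth false li) rev_rcons.
  store_with ltac:(rewrite ?eqxx //= ?(drop_nth false li) //=).
- by rewrite /I /upd drop_size eqxx; case: eqP.
by rewrite mulnC.
Qed.

(** A loop counted by the height of [a]: [J i] describes the store after [i] rounds except for [a]
    itself, which holds the part not yet consumed. *)
Lemma runs_for a body (J : nat -> store) B B' s s' :
  s = upd (J 0) a (s a) -> s' = upd (J (size (s a))) a [::] ->
  (forall i, i < size (s a) ->
     runs body (upd (J i) a (drop i.+1 (s a))) (upd (J i.+1) a (drop i.+1 (s a))) B) ->
  size (s a) * B.+2 < B' -> runs (While a (Seq (Pop a) body)) s s' B'.
Proof.
move=> Es Es' H l.
apply: (@runs_while _ _ (fun i => upd (J i) a (drop i (s a))) (size (s a)) B.+1) => //.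
- by rewrite drop0.
- by rewrite drop_size.
- move=> i li; rewrite {1}/upd eqxx (drop_nth false li); split=> //.
  apply: (@runs_seq _ _ _ (upd (J i) a (drop i.+1 (s a))) _ 1 B); last by rewrite add1n.
    set s1 := upd _ _ (_ :: _).
    have -> : upd (J i) a (drop i.+1 (s a)) = upd s1 a (behead (s1 a)).
      by rewrite /s1; store_with ltac:(rewrite ?eqxx).
    exact: runs_pop.
  exact: H.
by rewrite /upd eqxx drop_size.
Qed.

Definition clear a := While a (Pop a).

Lemma runs_clear a s B : 2 * size (s a) < B -> runs (clear a) s (upd s a [::]) B.
Proof.
move=> lB.
apply: (@runs_while _ _ (fun i => upd s a (drop i (s a))) (size (s a)) 1).
- rewrite drop0; store_eq.
- by rewrite drop_size.
- move=> i li; rewrite {1}/upd eqxx (drop_nth false li); split=> //.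
  set s1 := upd _ _ (_ :: _).
  have -> : upd s a (drop i.+1 (s a)) = upd s1 a (behead (s1 a)).
    by rewrite /s1; store_with ltac:(rewrite ?eqxx).
  exact: runs_pop.
- by rewrite /upd eqxx drop_size.
by rewrite mulnC.
Qed.

Definition drain a b := While a (Seq (Pop a) (Push b true)).

Lemma runs_drain a b s B : a != b -> 4 * size (s a) < B ->
  runs (drain a b) s (upd (upd s a [::]) b (nseq (size (s a)) true ++ s b)) B.
Proof.
move=> /eqP ab lB.
apply: (@runs_for _ _ (fun i => upd s b (nseq i true ++ s b)) 2).
- store_eq.
- store_eq.
- move=> i li; set s1 := upd _ a _.
  suff -> : upd (upd s b (nseq i.+1 true ++ s b)) a (drop i.+1 (s a)) = upd s1 b (true :: s1 b).
    exact: runs_push.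
  by rewrite /s1; store_with ltac:(rewrite ?eqxx).
by rewrite mulnC.
Qed.

(** Used both as truncated subtraction of unary numbers and, on a copy of an input, to advance to a
    given bit. *)
Definition subtract a b := While a (Seq (Pop a) (Pop b)).

Lemma runs_subtract a b s B : a != b -> 3 * size (s a) < B ->
  runs (subtract a b) s (upd (upd s a [::]) b (drop (size (s a)) (s b))) B.
Proof.
move=> /eqP ab lB.
apply: (@runs_for _ _ (fun i => upd s b (drop i (s b))) 1).
- rewrite drop0; store_eq.
- store_eq.
- move=> i li; set s1 := upd _ a _.
  suff -> : upd (upd s b (drop i.+1 (s b))) a (drop i.+1 (s a)) = upd s1 b (behead (s1 b)).
    exact: runs_pop.
  rewrite /s1; store_with ltac:(rewrite ?eqxx //= ?behead_drop // -?drop1 ?drop_drop //).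
by rewrite mulnC.
Qed.

(** Reading a stack destroys it: the content goes to [c], which reverses it, and then back to both
    [a] and [b], which restores the order. *)
Definition dup a b c :=
  Seq (transfer a c)
      (While c (Seq (If c (Seq (Push a true) (Push b true)) (Seq (Push a false) (Push b false)))
                    (Pop c))).

Lemma runs_dup a b c s B : a != b -> a != c -> b != c -> s c = [::] -> s b = [::] ->
  12 * size (s a) + 2 <= B -> runs (dup a b c) s (upd s b (s a)) B.
Proof.
move=> ab ac bc Ec Eb lB.
apply: (@runs_seq _ _ _ (upd (upd s a [::]) c (rev (s a))) _ (5 * size (s a)).+1 (7 * size (s a)).+1);
  last by lia.
  by have := @runs_transfer a c s (5 * size (s a)).+1 ac (ltnSn _); rewrite Ec cats0.
move: ab ac bc => /eqP ab /eqP ac /eqP bc.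
pose n := size (s a); pose l := rev (s a); have sl : size l = n by rewrite size_rev.
apply: (@runs_while _ _
  (fun i => upd (upd (upd s a (rev (take i l))) b (rev (take i l))) c (drop i l)) n 6).
- rewrite take0 drop0 /l; store_eq.
- rewrite -sl take_size drop_size /l revK; store_eq.
- move=> i li; have li' : i < size l by rewrite sl.
  rewrite {1}/upd eqxx (drop_nth false li'); split=> //.
  set s0 := upd _ c _; set x := nth false l i.
  pose s1 := upd s0 a (x :: s0 a); pose s2 := upd s1 b (x :: s1 b).
  apply: (@runs_seq _ _ _ s2 _ 5 1) => //.
    apply: (@runs_if _ _ _ _ _ 4) => //.
    have -> : s0 c = x :: drop i.+1 l by rewrite /s0 /upd eqxx.
    have : runs (Seq (Push a x) (Push b x)) s0 s2 4.
      by apply: (@runs_seq _ _ _ s1 _ 2 2) => //; apply: runs_push.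
    by rewrite /=; case: (x).
  set s3 := upd _ c _; have -> : s3 = upd s2 c (behead (s2 c)); last exact: runs_pop.
  rewrite /s3 /s2 /s1 /s0 (take_nth false li') rev_rcons.
  store_with ltac:(rewrite ?eqxx //).
- by rewrite /upd eqxx -sl drop_size.
by rewrite mulnC.
Qed.

(** * Bounded arithmetic in unary *)

(** [ESum] binds the de Bruijn variable 0. The bounded sum is the only iteration, which keeps unary
    values polynomial; products and bounded quantifiers are derived from it. *)
Inductive expr :=
| EOne
| EVar of nat
| ELen of nat
| EBit of nat & expr
| EAdd of expr & expr
| ESub of expr & expr
| ESum of expr & expr.

Definition scons T (x : T) (r : nat -> T) : nat -> T := fun i => if i is j.+1 then r j else x.

Fixpoint value (X : nat -> seq bool) (r : nat -> nat) (e : expr) : nat :=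
  match e with
  | EOne => 1
  | EVar i => r i
  | ELen k => size (X k)
  | EBit k a => nth false (X k) (value X r a)
  | EAdd a b => value X r a + value X r b
  | ESub a b => value X r a - value X r b
  | ESum a b => \sum_(i < value X r a) value X (scons (i : nat) r) b
  end.

(* Adds the value of [e], in unary, to the stack [dst]; the stacks from [fr] *)
(* on are free, and [inp] and [vs] locate the inputs and the variables.      *)
Fixpoint compile (inp : nat -> nat) (e : expr) (dst : nat) (vs : nat -> nat) (fr : nat) : cmd :=
  match e with
  | EOne => Push dst true
  | EVar i => Seq (dup (vs i) fr fr.+1) (drain fr dst)
  | ELen k => Seq (dup (inp k) fr fr.+1) (drain fr dst)
  | EBit k a =>
      Seq (compile inp a fr vs fr.+1)
     (Seq (dup (inp k) fr.+1 fr.+2)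
     (Seq (subtract fr fr.+1)
     (Seq (If fr.+1 (Push dst true) (Pop fr))
          (clear fr.+1))))
  | EAdd a b => Seq (compile inp a dst vs fr) (compile inp b dst vs fr)
  | ESub a b =>
      Seq (compile inp a fr vs fr.+1)
     (Seq (compile inp b fr.+1 vs fr.+2)
     (Seq (subtract fr.+1 fr) (drain fr dst)))
  | ESum a b =>
      Seq (compile inp a fr vs fr.+1)
     (Seq (While fr (Seq (Pop fr) (Seq (compile inp b dst (scons fr.+1 vs) fr.+2)
                                       (Push fr.+1 true))))
          (clear fr.+1))
  end.

(** [B] bounds the input sizes and the variables. Under a sum the index is a new variable bounded by
    the value of [a], hence the larger bound for [b]. *)
Fixpoint value_bound (e : expr) (B : nat) : nat :=
  match e with
  | EOne => 1
  | EVar _ | ELen _ => B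
  | EBit _ _ => 1
  | EAdd a b => value_bound a B + value_bound b B
  | ESub a _ => value_bound a B
  | ESum a b => value_bound a B * value_bound b (B + value_bound a B)
  end.

Fixpoint time_bound (e : expr) (B : nat) : nat :=
  match e with
  | EOne => 2
  | EVar _ | ELen _ => 16 * B + 3
  | EBit _ a => time_bound a B + (14 * B + 3 * value_bound a B + 7)
  | EAdd a b => time_bound a B + time_bound b B
  | ESub a b => time_bound a B + (time_bound b B + (3 * value_bound b B + 4 * value_bound a B + 2))
  | ESum a b =>
      time_bound a B + (value_bound a B * (time_bound b (B + value_bound a B) + 4)
                        + (2 * value_bound a B + 2))
  end.

Lemma value_le X r e B : (forall k, size (X k) <= B) -> (forall i, r i <= B) ->
  value X r e <= value_bound e B.
Proof.
elim: e r B => [|i|k|k a _|a IHa b IHb|a IHa b IHb|a IHa b IHb] r B HX Hr //=.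
- exact: leq_b1.
- by apply: leq_add; [apply: IHa|apply: IHb].
- exact: leq_trans (leq_subr _ _) (IHa _ _ HX Hr).
have la := IHa r B HX Hr.
apply: (@leq_trans (\sum_(i < value X r a) value_bound b (B + value_bound a B))).
  apply: leq_sum => i _; apply: IHb => [k|[|j] /=].
  - exact: leq_trans (HX k) (leq_addr _ _).
  - by apply: leq_trans (leq_addl _ _); apply: leq_trans la; apply: ltnW.
  exact: leq_trans (Hr j) (leq_addr _ _).
by rewrite sum_nat_const card_ord leq_mul2r la orbT.
Qed.

Section Compile.

Variables (inp : nat -> nat) (X : nat -> seq bool).

(** The destination may already hold bits, because summands accumulate on it; it must differ from
    the input and variable stacks, which are read again after it has been written. *)
Record ready dst vs fr (s : store) (r : nat -> nat) B : Prop := Ready {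
  ready_dst : dst < fr;
  ready_inp : forall k, [/\ inp k < fr, inp k != dst, s (inp k) = X k & size (X k) <= B];
  ready_var : forall i, [/\ vs i < fr, vs i != dst, size (s (vs i)) = r i & r i <= B];
  ready_free : forall j, fr <= j -> s j = [::] }.

Lemma ready_value dst vs fr s r B e : ready dst vs fr s r B -> value X r e <= value_bound e B.
Proof.
by case=> _ H1 H2 _; apply: value_le => k; [case: (H1 k)|case: (H2 k)].
Qed.

Lemma ready_local dst vs fr s r B v : ready dst vs fr s r B ->
  ready fr vs fr.+1 (upd s fr v) r B.
Proof.
case=> H0 H1 H2 H3; split=> //.
- move=> k; have [a b c d] := H1 k; split=> //; first exact: leqW.
    by rewrite neq_ltn a.
  by rewrite /upd; case: eqP => // e; rewrite e ltnn in a.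
- move=> k; have [a b c d] := H2 k; split=> //; first exact: leqW.
    by rewrite neq_ltn a.
  by rewrite /upd; case: eqP => // e; rewrite e ltnn in a.
by move=> j lj; rewrite /upd gtn_eqF // H3 // ltnW.
Qed.

Lemma ready_same dst vs fr s r B v : ready dst vs fr s r B -> ready dst vs fr (upd s dst v) r B.
Proof.
case=> H0 H1 H2 H3; split=> //.
- by move=> k; have [a b c d] := H1 k; split=> //; rewrite /upd (negbTE b).
- by move=> k; have [a b c d] := H2 k; split=> //; rewrite /upd (negbTE b).
by move=> j lj; rewrite /upd gtn_eqF ?H3 //; apply: leq_trans lj.
Qed.

Lemma ready_dup dst vs fr s r B a : ready dst vs fr s r B ->
  a < fr -> a != dst -> size (s a) <= B ->
  runs (Seq (dup a fr fr.+1) (drain fr dst)) s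
       (upd s dst (nseq (size (s a)) true ++ s dst)) (16 * B + 3).
Proof.
case=> H0 H1 H2 H3 la ad lB.
have [E1 E2] := (H3 fr (leqnn _), H3 fr.+1 (leqnSn _)).
apply: (@runs_seq _ _ _ (upd s fr (s a)) _ (12 * B + 2) (4 * B).+1); last by lia.
  by apply: runs_dup => //; lia.
suff -> : upd s dst (nseq (size (s a)) true ++ s dst) =
  upd (upd (upd s fr (s a)) fr [::]) dst
      (nseq (size (upd s fr (s a) fr)) true ++ upd s fr (s a) dst).
  by apply: runs_drain; [lia|rewrite /upd eqxx; lia].
by store_with ltac:(rewrite ?eqxx ?E1 //).
Qed.

(** Every stack except [dst] is restored, so the temporaries are empty again and can be reused by
    the next subexpression or loop round. *)
Lemma compile_runs e dst vs fr s r B : ready dst vs fr s r B ->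
  runs (compile inp e dst vs fr) s (upd s dst (nseq (value X r e) true ++ s dst)) (time_bound e B).
Proof.
elim: e dst vs fr s r B => [|i|k|k a IHa|a IHa b IHb|a IHa b IHb|a IHa b IHb]
  dst vs fr s r B rd /=.
- exact: runs_push.
- by have [a b <- d] := ready_var rd i; apply: ready_dup rd _ _ _ => //; lia.
- by have [a b <- d] := ready_inp rd k; apply: ready_dup rd _ _ _.
- have la := ready_value a rd; set v := value X r a in la *.
  have [k1 k2 k3 k4] := ready_inp rd k; have d1 := ready_dst rd.
  have F0 := ready_free rd (leqnn fr); have F1 := ready_free rd (leqnSn fr).
  have F2 : s fr.+2 = [::] by apply: (ready_free rd); lia.
  have RA := IHa fr vs fr.+1 s r B.
  pose s1 := upd s fr (nseq v true); pose s2 := upd s1 fr.+1 (X k).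
  pose s3 := upd s fr.+1 (drop v (X k)); pose s4 := upd s3 dst (nseq (nth false (X k) v) true ++ s dst).
  apply: (@runs_seq _ _ _ s1 _ (time_bound a B) (14 * B + 3 * value_bound a B + 7)) => //.
    have -> : s1 = upd s fr (nseq v true ++ s fr) by rewrite F0 cats0.
    apply: RA; have := ready_local [::] rd; congr ready; store_eq.
  apply: (@runs_seq _ _ _ s2 _ (12 * B + 2) (2 * B + 3 * value_bound a B + 5)); last by lia.
    have -> : s2 = upd s1 fr.+1 (s1 (inp k)).
      by rewrite /s2 [s1 (inp k)]upd_neq ?k3 //; lia.
    apply: runs_dup; rewrite ?/s1 ?upd_neq ?k3; try done; lia.
  apply: (@runs_seq _ _ _ s3 _ (3 * value_bound a B).+1 (2 * B + 4)); last by lia.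
    have -> : s3 = upd (upd s2 fr [::]) fr.+1 (drop (size (s2 fr)) (s2 fr.+1)).
      by rewrite /s3 /s2 /s1; store_with ltac:(rewrite ?eqxx ?size_nseq //).
    apply: runs_subtract; first by lia.
    by rewrite /s2 /s1 /upd eqxx (_ : fr == fr.+1 = false) ?size_nseq; lia.
  apply: (@runs_seq _ _ _ s4 _ 3 (2 * B + 1)); last by lia.
    apply: (@runs_if _ _ _ _ _ 2) => //.
    have -> : head false (s3 fr.+1) = nth false (X k) v.
      by rewrite /s3 /upd eqxx -nth0 nth_drop addn0.
    rewrite /s4; case: nth => /=.
      have -> : s dst = s3 dst by rewrite /s3 /upd (_ : dst == fr.+1 = false) //; lia.
      exact: runs_push.
    (* The stack [fr] is empty at this point, so the [Pop] in the else branch does nothing. *)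
    have -> : upd s3 dst (s dst) = upd s3 fr (behead (s3 fr)); last exact: runs_pop.
    by rewrite /s3; store_with ltac:(rewrite ?eqxx ?F0 //).
  have -> : upd s dst (nseq (nth false (X k) v) true ++ s dst) = upd s4 fr.+1 [::].
    by rewrite /s4 /s3; store_eq.
  apply: runs_clear; rewrite /s4 /s3 /upd eqxx (_ : fr.+1 == dst = false); last by lia.
  by rewrite size_drop; lia.
- apply: (@runs_seq _ _ _ _ _ (time_bound a B) (time_bound b B)) => //.
    exact: IHa rd.
  have := IHb _ _ _ _ _ _ (ready_same (nseq (value X r a) true ++ s dst) rd).
  congr runs; rewrite addnC nseqD; store_with ltac:(rewrite ?eqxx ?catA //).
- have la := ready_value a rd; have lb := ready_value b rd.
  set va := value X r a in la *; set vb := value X r b in lb *; have d1 := ready_dst rd.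
  have F0 := ready_free rd (leqnn fr); have F1 := ready_free rd (leqnSn fr).
  pose s1 := upd s fr (nseq va true); pose s2 := upd s1 fr.+1 (nseq vb true).
  pose s3 := upd s fr (nseq (va - vb) true).
  apply: (@runs_seq _ _ _ s1 _ (time_bound a B) (time_bound b B + (3 * value_bound b B + 4 * value_bound a B + 2))) => //.
    have -> : s1 = upd s fr (nseq va true ++ s fr) by rewrite F0 cats0.
    apply: IHa; have := ready_local [::] rd; congr ready; store_eq.
  apply: (@runs_seq _ _ _ s2 _ (time_bound b B) (3 * value_bound b B + 4 * value_bound a B + 2)) => //.
    have -> : s2 = upd s1 fr.+1 (nseq vb true ++ s1 fr.+1).
      by rewrite [s1 fr.+1]upd_neq ?F1 ?cats0 //; lia.
    apply: IHb; have := ready_local [::] (ready_local (nseq va true) rd).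
    by rewrite /s1; congr ready; store_eq.
  apply: (@runs_seq _ _ _ s3 _ (3 * value_bound b B).+1 (4 * value_bound a B).+1); last by lia.
    have -> : s3 = upd (upd s2 fr.+1 [::]) fr (drop (size (s2 fr.+1)) (s2 fr)).
      rewrite /s3 /s2 /s1; store_with ltac:(rewrite ?eqxx ?size_nseq ?drop_nseq //).
    apply: runs_subtract; first by lia.
    by rewrite /s2 /upd eqxx size_nseq; lia.
  have -> : upd s dst (nseq (va - vb) true ++ s dst) =
            upd (upd s3 fr [::]) dst (nseq (size (s3 fr)) true ++ s3 dst).
    by rewrite /s3; store_with ltac:(rewrite ?eqxx ?size_nseq //).
  by apply: runs_drain; [lia|rewrite /s3 /upd eqxx size_nseq; lia].
have la := ready_value a rd; set va := value X r a in la *; have d1 := ready_dst rd.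
set wb := value_bound a B in la *.
have F0 := ready_free rd (leqnn fr); have F1 := ready_free rd (leqnSn fr).
pose s1 := upd s fr (nseq va true).
pose S i := \sum_(j < i) value X (scons (j : nat) r) b.
(* After [i] rounds the stack [fr.+1] holds the summation index in unary and [dst] has received the
   partial sum. *)
pose J i := upd (upd s fr.+1 (nseq i true)) dst (nseq (S i) true ++ s dst).
apply: (@runs_seq _ _ _ s1 _ (time_bound a B) (wb * (time_bound b (B + wb) + 4) + (2 * wb + 2))) => //.
  have -> : s1 = upd s fr (nseq va true ++ s fr) by rewrite F0 cats0.
  apply: IHa; have := ready_local [::] rd; congr ready; store_eq.
apply: (@runs_seq _ _ _ (J va) _ (wb * (time_bound b (B + wb) + 4)).+1 (2 * wb + 1)); last by lia.
  have E1 : s1 fr = nseq va true by rewrite /s1 /upd eqxx.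
  apply: (@runs_for _ _ J (time_bound b (B + wb) + 2)); rewrite ?E1 ?size_nseq.
  - by rewrite /s1 /J /S big_ord0; store_eq.
  - by rewrite /J; store_eq.
  - move=> i li; set s2 := upd (J i) _ _.
    apply: (@runs_seq _ _ _ (upd s2 dst (nseq (value X (scons i r) b) true ++ s2 dst)) _
             (time_bound b (B + wb)) 2) => //.
      apply: IHb; split.
      - by lia.
      - move=> k; have [a1 a2 a3 a4] := ready_inp rd k; split=> //; try lia.
        rewrite /s2 /J /upd (_ : inp k == fr = false); last by lia.
        by rewrite (negbTE a2) (_ : inp k == fr.+1 = false) //; lia.
      - case=> [|j] /=.
          split; try lia; rewrite /s2 /J /upd.
          rewrite (_ : fr.+1 == fr = false); last by lia.
          by rewrite (_ : fr.+1 == dst = false) ?eqxx ?size_nseq //; lia.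
        have [a1 a2 a3 a4] := ready_var rd j; split=> //; try lia.
        rewrite /s2 /J /upd (_ : vs j == fr = false); last by lia.
        by rewrite (negbTE a2) (_ : vs j == fr.+1 = false) //; lia.
      - move=> j lj; rewrite /s2 /J /upd (_ : j == fr = false); last by lia.
        rewrite (_ : j == dst = false); last by lia.
        by rewrite (_ : j == fr.+1 = false) ?(ready_free rd) //; lia.
    set s3 := upd s2 dst _.
    have -> : upd (J i.+1) fr (drop i.+1 (nseq va true)) = upd s3 fr.+1 (true :: s3 fr.+1).
      rewrite /s3 /s2 /J /S big_ord_recr /= addnC nseqD.
      by store_with ltac:(rewrite ?eqxx ?catA //).
    exact: runs_push.
  have : va * (time_bound b (B + wb) + 4) <= wb * (time_bound b (B + wb) + 4) by apply: leq_mul.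
  by lia.
have -> : upd s dst (nseq (S va) true ++ s dst) = upd (J va) fr.+1 [::].
  by rewrite /J; store_eq.
apply: runs_clear; rewrite /J /upd eqxx (_ : fr.+1 == dst = false) ?size_nseq; lia.
Qed.

End Compile.

Lemma within_leq K K' c : K <= K' -> within K c -> within K' c.
Proof.
move=> l; elim: c => [k b|k|a IHa b IHb|k a IHa b IHb|k a IHa] /=.
- by move=> kK; apply: leq_trans l.
- by move=> kK; apply: leq_trans l.
- by move=> /andP[/IHa -> /IHb ->].
- by move=> /and3P[kK /IHa -> /IHb ->]; rewrite (leq_trans kK l).
by move=> /andP[kK /IHa ->]; rewrite (leq_trans kK l).
Qed.

Lemma within_ex c : exists K, within K c.
Proof.
elim: c => [k b|k|a [Ka wa] b [Kb wb]|k a [Ka wa] b [Kb wb]|k a [Ka wa]] /=.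
- by exists k.
- by exists k.
- exists (maxn Ka Kb).
  by rewrite (within_leq _ wa) ?leq_maxl // (within_leq _ wb) ?leq_maxr.
- exists (maxn k (maxn Ka Kb)); rewrite leq_maxl.
  rewrite (within_leq _ wa) ?(within_leq _ wb) //.
    by rewrite leq_max leq_maxr orbT.
  by rewrite leq_max leq_maxl orbT.
by exists (maxn k Ka); rewrite leq_maxl (within_leq _ wa) ?leq_maxr.
Qed.

(** * Polynomial bounds and polynomial-time evaluation *)

Definition poly_bounded (f : nat -> nat) := exists p : {poly nat}, forall n, f n <= p.[n]%R.

Lemma horner_leq (p : {poly nat}) a b : a <= b -> p.[a]%R <= p.[b]%R.
Proof.
move=> l; elim/poly_ind: p => [|p c IH]; first by rewrite !horner0.
rewrite !hornerMXaddC; apply: leq_add => //; exact: leq_mul.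
Qed.

Lemma poly_bounded_const c : poly_bounded (fun _ => c).
Proof. by exists c%:P%R => n; rewrite hornerC. Qed.

Lemma poly_bounded_id : poly_bounded id.
Proof. by exists 'X%R => n; rewrite hornerX. Qed.

Lemma poly_bounded_add f g : poly_bounded f -> poly_bounded g ->
  poly_bounded (fun n => f n + g n).
Proof. by move=> [p P] [q Q]; exists (p + q)%R => n; rewrite hornerD; apply: leq_add. Qed.

Lemma poly_bounded_mul f g : poly_bounded f -> poly_bounded g ->
  poly_bounded (fun n => f n * g n).
Proof. by move=> [p P] [q Q]; exists (p * q)%R => n; rewrite hornerM; apply: leq_mul. Qed.

Lemma poly_bounded_comp f g : poly_bounded f -> poly_bounded g ->
  poly_bounded (fun n => f (g n)).
Proof.
move=> [p P] [q Q]; exists (p \Po q)%R => n; rewrite horner_comp.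
exact: leq_trans (P _) (horner_leq _ (Q n)).
Qed.

Create HintDb polyb.
#[local] Hint Resolve poly_bounded_const poly_bounded_id poly_bounded_add poly_bounded_mul : polyb.

Lemma value_bound_poly e : poly_bounded (value_bound e).
Proof.
elim: e => [|i|k|k a _|a IHa b IHb|a IHa b IHb|a IHa b IHb] /=; auto with polyb.
apply: poly_bounded_mul => //.
by apply: (poly_bounded_comp IHb); auto with polyb.
Qed.

#[local] Hint Resolve value_bound_poly : polyb.

Lemma time_bound_poly e : poly_bounded (time_bound e).
Proof.
elim: e => [|i|k|k a IHa|a IHa b IHb|a IHa b IHb|a IHa b IHb] /=; auto 10 with polyb.
do 2![apply: poly_bounded_add => //]; auto with polyb.
apply: poly_bounded_mul; auto with polyb.
apply: poly_bounded_add; auto with polyb.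
by apply: (poly_bounded_comp IHb); auto with polyb.
Qed.

#[local] Hint Resolve time_bound_poly : polyb.

Definition inputs1 (x : seq bool) : nat -> seq bool := fun k => nth [::] [:: x] k.
Definition inputs2 (x y : seq bool) : nat -> seq bool := fun k => nth [::] [:: x; y] k.
Definition no_vars : nat -> nat := fun=> 0.

Lemma polytime_rel_value e :
  polytime_rel (fun x y => value (inputs2 x y) no_vars e != 0).
Proof.
(* Stacks 0 and 1 hold the inputs, the empty stack 2 stands for all other inputs and all variables,
   and stack 3 collects the value. *)
pose c := Seq (compile (fun k => minn k 2) e 3 (fun=> 2) 4)
         (Seq (clear 0) (If 3 (Push 0 true) (Push 0 false))).
have [K w] := within_ex c.
have [p P] : poly_bounded (fun B => time_bound e B + ((2 * B).+1 + 3)).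
  apply: poly_bounded_add; auto with polyb.
  apply: poly_bounded_add; auto with polyb.
  have : poly_bounded (fun B => 1 + 2 * B) by auto with polyb.
  by [].
exists (compiled K c), p => x y; set B := size x + size y.
pose s : store := fun j => nth [::] [:: x; y] j.
set v := value _ _ e; set b := v != 0.
suff [t E l] : runs c s (upd (upd s 3 (nseq v true)) 0 [:: b]) (time_bound e B + ((2 * B).+1 + 3)).
  by apply: (exec_outputs E w); apply: leq_trans l (P _).
apply: (@runs_seq _ _ _ (upd s 3 (nseq v true ++ s 3)) _ (time_bound e B) ((2 * B).+1 + 3)) => //.
  apply: compile_runs; split=> //.
  - move=> k; split=> //; rewrite ?gtn_min ?ltn_min ?orbT ?andbT //.
    + by rewrite neq_ltn gtn_min orbT.
    + by case: k => [|[|k]] //=; rewrite /s /inputs2 /= ?nth_nil // (minn_idPr _).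
    by rewrite /inputs2; case: k => [|[|k]] /=; rewrite ?nth_nil //= /B ?leq_addr ?leq_addl.
  by move=> j lj; rewrite /s nth_default //=; lia.
rewrite cats0.
apply: (@runs_seq _ _ _ (upd (upd s 3 (nseq v true)) 0 [::]) _ (2 * B).+1 3) => //.
  apply: runs_clear; rewrite /upd /= /s /B /=; lia.
apply: (@runs_if _ _ _ _ _ 2) => //.
set s1 := upd _ 0 [::].
have -> : upd (upd s 3 (nseq v true)) 0 [:: b] = upd s1 0 (b :: s1 0).
  by rewrite /s1; store_eq.
have -> : head false (s1 3) = b by rewrite /s1 /upd /= /b; case: (v).
by case: (b); apply: runs_push.
Qed.

(** The input is copied to stack 1, since stack 0 receives the output. Stack 3 counts down; once
    popped, it is the index of the bit to compute and is read as variable 0. The bits are pushed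
    from last to first, which leaves them in order. *)
Lemma polytime_fun_value eN e :
  polytime_fun (fun x => mkseq (fun j => value (inputs1 x) (scons j no_vars) e != 0)
                               (value (inputs1 x) no_vars eN)).
Proof.
pose inp k := if k == 0 then 1 else 2.
pose body := Seq (compile inp e 4 (scons 3 (fun=> 2)) 5)
            (Seq (If 4 (Push 0 true) (Push 0 false)) (clear 4)).
pose c := Seq (dup 0 1 3) (Seq (clear 0) (Seq (compile inp eN 3 (fun=> 2) 4)
          (While 3 (Seq (Pop 3) body)))).
have [K w] := within_ex c.
pose tb B := time_bound e (B + value_bound eN B) + (3 + (2 * value_bound e (B + value_bound eN B) + 1)).
pose T B := (12 * B + 2) + ((2 * B + 1) + (time_bound eN B + (value_bound eN B * (2 + tb B) + 1))).
have [p P] : poly_bounded T.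
  have comp f : poly_bounded f -> poly_bounded (fun B => f (B + value_bound eN B)).
    by move=> pf; apply: poly_bounded_comp; auto with polyb.
  have pt : poly_bounded tb.
    by do !apply: poly_bounded_add; auto with polyb; apply: poly_bounded_mul; auto with polyb.
  by rewrite /T; do 3![apply: poly_bounded_add; auto with polyb].
exists (compiled K c), p => x; set B := size x.
pose s : store := fun j => nth [::] [:: x] j.
set N := value _ _ eN.
pose v j := value (inputs1 x) (scons j no_vars) e.
rewrite -[mkseq _ _]/(mkseq (fun j => v j != 0) N).
have Nle : N <= value_bound eN B.
  apply: value_le => // k; rewrite /inputs1; case: k => [|k] //=; by rewrite nth_nil.
suff [t E l] : runs c s (upd (upd s 1 x) 0 (mkseq (fun j => v j != 0) N)) (T B).
  by apply: (exec_outputs E w); apply: leq_trans l (P _).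
have I j : [/\ inp j < 4, inp j < 5, inp j != 3 & inp j != 4] by rewrite /inp; case: eqP.
have IB k : size (inputs1 x k) <= B by rewrite /inputs1; case: k => [|k] //=; rewrite nth_nil.
apply: (@runs_seq _ _ _ (upd s 1 x) _ (12 * B + 2)
  ((2 * B + 1) + (time_bound eN B + (value_bound eN B * (2 + tb B) + 1)))) => //.
  exact: runs_dup.
pose s1 := upd (upd s 1 x) 0 [::].
apply: (@runs_seq _ _ _ s1 _ (2 * B + 1) (time_bound eN B + (value_bound eN B * (2 + tb B) + 1))) => //.
  by apply: runs_clear; rewrite /upd /= addn1.
have s1E k : s1 (inp k) = inputs1 x k.
  by rewrite /s1 /inp /inputs1; case: k => [|k] /=; rewrite /upd //= nth_nil.
apply: (@runs_seq _ _ _ (upd s1 3 (nseq N true)) _ (time_bound eN B) (value_bound eN B * (2 + tb B) + 1)) => //.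
  have -> : nseq N true = nseq N true ++ s1 3 by rewrite /s1 /upd /= cats0.
  apply: compile_runs; split=> //.
  - by move=> k; have [? ? ? ?] := I k.
  by move=> j lj; rewrite /s1 /upd; case: eqP => [?|_]; [lia|]; case: eqP => [?|_]; [lia|]; rewrite /s nth_default //=; lia.
pose J i := upd s1 0 (mkseq (fun j => v (N - i + j) != 0) i).
apply: (@runs_for _ _ J (tb B)); rewrite ?upd_eq ?size_nseq.
- by rewrite /J /s1; store_eq.
- rewrite /J /s1 subnn; store_eq.
- move=> i li; rewrite drop_nseq subnS; set n := (N - i).-1.
  have ni : N - i = n.+1 by rewrite /n; lia.
  pose s2 := upd (J i) 3 (nseq n true); rewrite -/s2.
  have vle : v n <= value_bound e (B + value_bound eN B).
    apply: value_le => [k|[|k]] //=; first by apply: leq_trans (IB k) (leq_addr _ _).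
    by rewrite /n; lia.
  apply: (@runs_seq _ _ _ (upd s2 4 (nseq (v n) true)) _ (time_bound e (B + value_bound eN B))
     (3 + (2 * value_bound e (B + value_bound eN B) + 1))) => //.
    have -> : nseq (v n) true = nseq (v n) true ++ s2 4 by rewrite /s2 /J /s1 /upd /= cats0.
    apply: compile_runs; split=> //.
    + move=> k; have [? ? ? ?] := I k; split=> //.
        have i0 : inp k != 0 by rewrite /inp; case: (k == 0).
        by rewrite /s2 /J (upd_neq _ _ (k := 3)) // (upd_neq _ _ i0) s1E.
      by apply: leq_trans (IB k) (leq_addr _ _).
    + case=> [|k]; split=> //; first exact: size_nseq.
      by rewrite /n /=; lia.
    move=> j lj; rewrite /s2 /J /s1 !upd_neq; try lia.
    by rewrite /s nth_default //=; lia.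
  pose s3 := upd (upd s2 4 (nseq (v n) true)) 0 ((v n != 0) :: s2 0).
  apply: (@runs_seq _ _ _ s3 _ 3 (2 * value_bound e (B + value_bound eN B) + 1)) => //.
    apply: (@runs_if _ _ _ _ _ 2) => //; rewrite upd_eq /s3.
    have -> : s2 0 = upd s2 4 (nseq (v n) true) 0 by rewrite [RHS]upd_neq.
    by case: (v n) => [|m]; apply: runs_push.
  have -> : upd (J i.+1) 3 (nseq n true) = upd s3 4 [::].
    rewrite /s3 /s2 /J subnS ni /=.
    have -> : mkseq (fun j => v (n + j) != 0) i.+1 =
      (v n != 0) :: mkseq (fun j => v (n.+1 + j) != 0) i.
      rewrite /mkseq /= addn0; congr cons; rewrite -[1]/(1 + 0) iotaDl -map_comp.
      by apply: eq_map => j /=; rewrite addnCA addnA.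
    by rewrite /s1; store_eq.
  apply: runs_clear; rewrite /s3 upd_neq // upd_eq size_nseq; lia.
have : N * (tb B).+2 <= value_bound eN B * (tb B).+2 by apply: leq_mul.
by rewrite add2n; lia.
Qed.

(** * Definability *)

Definition bex (n : nat) (P : nat -> bool) : bool := has P (iota 0 n).
Definition ball (n : nat) (P : nat -> bool) : bool := ~~ bex n (fun i => ~~ P i).

(** The type does not depend on the input, so in an expression this quantifier is a fixed finite
    disjunction. *)
Definition fex (T : finType) (P : T -> bool) : bool := has P (enum T).

Lemma fexP (T : finType) (P : T -> bool) : reflect (exists x, P x) (fex P).
Proof. by apply: (iffP hasP) => [[x _ Px]|[x Px]]; exists x; rewrite ?mem_enum. Qed.

Lemma bexP n (P : nat -> bool) : reflect (exists2 i, i < n & P i) (bex n P).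
Proof.
by apply: (iffP hasP) => -[i]; [rewrite mem_iota add0n|] => li Pi; exists i; rewrite ?mem_iota.
Qed.

Lemma ballP n (P : nat -> bool) : reflect (forall i, i < n -> P i) (ball n P).
Proof.
apply: (iffP idP) => [/bexP H i li|H].
  by apply/negPn/negP => nP; apply: H; exists i.
by apply/bexP => -[i /H ->].
Qed.

Fixpoint rename (f : nat -> nat) (e : expr) : expr :=
  match e with
  | EOne => EOne
  | EVar i => EVar (f i)
  | ELen k => ELen k
  | EBit k a => EBit k (rename f a)
  | EAdd a b => EAdd (rename f a) (rename f b)
  | ESub a b => ESub (rename f a) (rename f b)
  | ESum a b => ESum (rename f a) (rename (fun i => if i is j.+1 then (f j).+1 else 0) b)
  end.

Lemma value_rename X e : forall f r, value X r (rename f e) = value X (fun i => r (f i)) e.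
Proof.
elim: e => [|i|k|k a IHa|a IHa b IHb|a IHa b IHb|a IHa b IHb] f r //=; rewrite ?IHa ?IHb //.
apply: eq_bigr => i _; rewrite IHb; congr value.
by apply: functional_extensionality => -[].
Qed.

(** Expressions for the concrete tests are never written out; their existence follows from closure
    properties. *)
Definition definable (F : (nat -> seq bool) -> (nat -> nat) -> nat) : Prop :=
  exists e, forall X r, value X r e = F X r.

Definition definableb (P : (nat -> seq bool) -> (nat -> nat) -> bool) : Prop :=
  definable (fun X r => P X r).

Lemma def_var i : definable (fun X r => r i).
Proof. by exists (EVar i). Qed.

Lemma def_size k : definable (fun X r => size (X k)).
Proof. by exists (ELen k). Qed.

Lemma def_add f g : definable f -> definable g -> definable (fun X r => f X r + g X r).
Proof. by move=> [a A] [b B]; exists (EAdd a b) => X r /=; rewrite A B. Qed.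

Lemma def_sub f g : definable f -> definable g -> definable (fun X r => f X r - g X r).
Proof. by move=> [a A] [b B]; exists (ESub a b) => X r /=; rewrite A B. Qed.

Lemma def_const c : definable (fun X r => c).
Proof.
elim: c => [|c [a A]]; first by exists (ESub EOne EOne).
by exists (EAdd EOne a) => X r /=; rewrite A.
Qed.

Lemma def_sum f (G : (nat -> seq bool) -> (nat -> nat) -> nat -> nat) :
  definable f -> definable (fun X r => G X (fun i => r i.+1) (r 0)) ->
  definable (fun X r => \sum_(i < f X r) G X r i).
Proof.
by move=> [a A] [b B]; exists (ESum a b) => X r /=; rewrite A; apply: eq_bigr => i _; rewrite B.
Qed.

Lemma def_shift f : definable f -> definable (fun X r => f X (fun i => r i.+1)).
Proof. by move=> [a A]; exists (rename succn a) => X r; rewrite value_rename A. Qed.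

Lemma def_ext f g : (forall X r, f X r = g X r) -> definable f -> definable g.
Proof. by move=> E [a A]; exists a => X r; rewrite A E. Qed.

Lemma def_mul f g : definable f -> definable g -> definable (fun X r => f X r * g X r).
Proof.
move=> df dg; apply: def_ext (def_sum (G := fun X r _ => g X r) df (def_shift dg)) => X r /=.
by rewrite sum_nat_const card_ord.
Qed.

Lemma def_nth k f : definable f -> definableb (fun X r => nth false (X k) (f X r)).
Proof. by move=> [a A]; exists (EBit k a) => X r /=; rewrite A. Qed.

Lemma def_leq f g : definable f -> definable g -> definableb (fun X r => f X r <= g X r).
Proof.
move=> df dg; apply: def_ext (def_sub (def_const 1) (def_sub df dg)) => X r.
by rewrite /leq; case: (f X r - g X r).
Qed.

Lemma def_bconst (b : bool) : definableb (fun X r => b).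
Proof. exact: def_const. Qed.

Lemma def_not a : definableb a -> definableb (fun X r => ~~ a X r).
Proof. by move=> da; apply: def_ext (def_sub (def_const 1) da) => X r; case: (a X r). Qed.

Lemma def_and a b : definableb a -> definableb b -> definableb (fun X r => a X r && b X r).
Proof. by move=> da db; apply: def_ext (def_mul da db) => X r; case: (a X r); case: (b X r). Qed.

Lemma defb_ext f g : (forall X r, f X r = g X r) -> definableb f -> definableb g.
Proof. by move=> E; apply: def_ext => X r; rewrite E. Qed.

Lemma def_or a b : definableb a -> definableb b -> definableb (fun X r => a X r || b X r).
Proof.
move=> da db; apply: defb_ext (def_not (def_and (def_not da) (def_not db))) => X r /=.
by rewrite negb_and !negbK.
Qed.

Lemma def_imply a b : definableb a -> definableb b -> definableb (fun X r => a X r ==> b X r).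
Proof.
by move=> da db; apply: defb_ext (def_or (def_not da) db) => X r; rewrite implybE.
Qed.

Lemma def_eq f g : definable f -> definable g -> definableb (fun X r => f X r == g X r).
Proof.
move=> df dg; apply: defb_ext (def_and (def_leq df dg) (def_leq dg df)) => X r.
by rewrite -eqn_leq.
Qed.

Lemma def_bex f (P : (nat -> seq bool) -> (nat -> nat) -> nat -> bool) :
  definable f -> definableb (fun X r => P X (fun i => r i.+1) (r 0)) ->
  definableb (fun X r => bex (f X r) (P X r)).
Proof.
move=> df dP.
have dS := def_sum (G := fun X r i => P X r i) df dP.
apply: defb_ext (def_not (def_eq dS (def_const 0))) => X r.
rewrite sum_nat_eq0; apply/idP/bexP.
  by case/forallPn => i /=; rewrite eqb0 negbK => Pi; exists (i : nat).
by move=> [i li Pi]; apply/forallPn; exists (Ordinal li); rewrite /= Pi.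
Qed.

Lemma def_ball f (P : (nat -> seq bool) -> (nat -> nat) -> nat -> bool) :
  definable f -> definableb (fun X r => P X (fun i => r i.+1) (r 0)) ->
  definableb (fun X r => ball (f X r) (P X r)).
Proof.
move=> df dP; apply/def_not.
by apply: (def_bex (P := fun X r i => ~~ P X r i)) => //; apply: def_not.
Qed.

Lemma def_fex (T : finType) (P : (nat -> seq bool) -> (nat -> nat) -> T -> bool) :
  (forall x, definableb (fun X r => P X r x)) -> definableb (fun X r => fex (P X r)).
Proof.
rewrite /fex; move=> dP; elim: (enum T) => [|x s IH] /=.
  exact: def_bconst.
exact: def_or.
Qed.

Lemma def_horner (p : {poly nat}) f : definable f -> definable (fun X r => p.[f X r]%R).
Proof.
move=> df; elim/poly_ind: p => [|p c IH].
  by apply: def_ext (def_const 0) => X r; rewrite horner0.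
by apply: def_ext (def_add (def_mul IH df) (def_const c)) => X r; rewrite hornerMXaddC.
Qed.

Ltac definability :=
  lazymatch goal with
  | |- definable (fun X r => _ + _) => apply: def_add; definability
  | |- definable (fun X r => _ * _) => apply: def_mul; definability
  | |- definable (fun X r => _ - _) => apply: def_sub; definability
  | |- definable (fun X r => (_.[_])%R) => apply: def_horner; definability
  | |- definable (fun X r => size _) => apply: def_size
  | |- definable (fun X r => r _) => apply: def_var
  | |- definable (fun X r => ?c.+1) => apply: (def_add (def_const 1)); definability
  | |- definable (fun X r => nat_of_bool _) => rewrite -/(definableb _); definability
  | |- definable _ => first [assumption | exact: def_const]
  | |- definableb (fun X r => _ && _) => apply: def_and; definability
  | |- definableb (fun X r => _ || _) => apply: def_or; definability
  | |- definableb (fun X r => _ ==> _) => apply: def_imply; definability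
  | |- definableb (fun X r => ~~ _) => apply: def_not; definability
  | |- definableb (fun X r => _ <= _) => apply: def_leq; definability
  | |- definableb (fun X r => _ == _ :> nat) => first [exact: def_bconst | apply: def_eq; definability]
  | |- definableb (fun X r => bex _ _) => apply: def_bex; definability
  | |- definableb (fun X r => fex _) => apply: def_fex => ?; definability
  | |- definableb (fun X r => ball _ _) => apply: def_ball; definability
  | |- definableb (fun X r => nth false _ _) => apply: def_nth; definability
  | |- definableb _ => first [assumption | exact: def_bconst | idtac]
  | _ => idtac
  end.

(** A positive number is a power of 2 iff each of its divisors is 1 or even; this avoids
    exponentiation, which bounded expressions cannot define. *)
Definition is_pow2 n := (0 < n) && ball n.+1 (fun i => ball n.+1 (fun j =>
  (i * j == n) ==> (i == 1) || bex i (fun k => k + k == i))).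

Lemma def_is_pow2 f : definable f -> definableb (fun X r => is_pow2 (f X r)).
Proof.
move=> df; have df1 := def_shift df; have df2 := def_shift df1.
rewrite /is_pow2; definability.
Qed.

Lemma is_pow2P n : reflect (exists e, n = 2 ^ e) (is_pow2 n).
Proof.
apply: (iffP andP) => [[n0 /ballP H]|[e ->]].
  (* The odd part [m] of [n] is an odd divisor, hence equal to 1. *)
  have [m] := pfactor_coprime (isT : prime 2) n0; rewrite coprime2n => om E.
  have m0 : 0 < m by case: (m) om.
  have le1 : m < n.+1 by rewrite ltnS {1}E leq_pmulr // expn_gt0.
  have le2 : 2 ^ logn 2 n < n.+1 by rewrite ltnS {2}E leq_pmull.
  have /ballP/(_ _ le2)/implyP := H _ le1; rewrite -E eqxx => /(_ isT).
  case/orP => [/eqP m1|/bexP[k _ /eqP km]]; last by rewrite -km oddD addbb in om.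
  by exists (logn 2 n); rewrite {1}E m1 mul1n.
split; first by rewrite expn_gt0.
apply/ballP => i _; apply/ballP => j _; apply/implyP => /eqP E.
have : i %| 2 ^ e by rewrite -E dvdn_mulr.
case/dvdn_pfactor => // -[|k] _ ->; first by rewrite expn0.
apply/orP; right; apply/bexP; exists (2 ^ k); first by rewrite ltn_exp2l.
by rewrite addnn -mul2n -expnS.
Qed.

(** For positive Z the interval [Z, 2Z) contains exactly one power of 2, so the sum has a single
    non-zero term. *)
Definition next_pow2 Z := \sum_(k < 2 * Z) k * (is_pow2 k && (Z <= k)).

Lemma def_next_pow2 f : definable f -> definable (fun X r => next_pow2 (f X r)).
Proof.
move=> df; have df1 := def_shift df.
apply: (def_sum (G := fun X r k => k * (is_pow2 k && (f X r <= k)))); definability.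
apply: def_is_pow2; definability.
Qed.

Lemma next_pow2P Z : 0 < Z -> Z <= next_pow2 Z /\ exists e, next_pow2 Z = 2 ^ e.
Proof.
move=> Z0; pose e := up_log 2 Z.
have le : Z <= 2 ^ e by apply: up_logP.
have lt : 2 ^ e < 2 * Z.
  rewrite /e; case: (ltnP 1 Z) => [Z1|Z1]; last by have -> : Z = 1 by lia.
  have := up_log_bounds (isT : 1 < 2) Z1; case E: (up_log 2 Z) => [|k] /=; first by lia.
  by rewrite expnS => /andP[]; lia.
suff -> : next_pow2 Z = 2 ^ e by split=> //; exists e.
rewrite /next_pow2 (bigD1 (Ordinal lt)) //= le andbT big1.
  by have /is_pow2P -> : exists f, 2 ^ e = 2 ^ f; [exists e|rewrite muln1 addn0].
move=> i /eqP ne; case: andP => [[/is_pow2P[f Ef] lf]|_]; last by rewrite muln0.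
case: ne; apply: val_inj => /=; have li := ltn_ord i.
rewrite Ef in li lf *; congr (2 ^ _); apply/eqP; rewrite eqn_leq.
apply/andP; split; rewrite -ltnS -(ltn_exp2l _ _ (isT : 1 < 2)) expnS.
  by apply: leq_trans li _; rewrite leq_mul2l le.
by apply: leq_trans lt _; rewrite leq_mul2l lf.
Qed.

(** * Bits *)

Lemma of_bitsD k n f : of_bits (k + n) f = of_bits k f + 2 ^ k * of_bits n (fun i => f (k + i)).
Proof.
rewrite /of_bits big_split_ord /= big_distrr /=; congr (_ + _).
by apply: eq_bigr => i _; rewrite expnD mulnCA.
Qed.

Lemma of_bits_lt n f : of_bits n f < 2 ^ n.
Proof.
elim: n => [|n IH]; first by rewrite /of_bits big_ord0.
rewrite -[n.+1]addn1 of_bitsD {2}/of_bits big_ord1 muln1 expnD expn1 /=.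
by case: (f _); lia.
Qed.

Lemma eq_of_bits n f g : (forall i, i < n -> f i = g i) -> of_bits n f = of_bits n g.
Proof. by move=> E; apply: eq_bigr => i _; rewrite E. Qed.

Lemma of_bits_eq0 n f : of_bits n f = 0 <-> forall i, i < n -> ~~ f i.
Proof.
split=> [/eqP|H].
  rewrite sum_nat_eq0 => /forallP H i li; have := H (Ordinal li).
  by rewrite /= muln_eq0 expn_eq0 /= orbF; case: (f i).
by apply: big1 => i _; rewrite (negbTE (H i _)).
Qed.

Lemma of_bits_gt0 n f : 0 < of_bits n f <-> exists2 i, i < n & f i.
Proof.
split=> [h|[i li fi]].
  case: (pickP (fun i : 'I_n => f i)) => [i fi|H]; first by exists (i : nat).
  by rewrite (of_bits_eq0 n f).2 // in h => i li; have /= := H (Ordinal li) => ->.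
by rewrite lt0n; apply/eqP => /of_bits_eq0/(_ i li); rewrite fi.
Qed.

Lemma of_bits_widen k n f : k <= n -> (forall i, k <= i < n -> f i = false) ->
  of_bits n f = of_bits k f.
Proof.
move=> l H; rewrite -(subnKC l) of_bitsD [X in _ * X](of_bits_eq0 _ _).2 ?muln0 ?addn0 //.
by move=> i li; rewrite H // leq_addr /=; lia.
Qed.

Lemma bit_addl k z y i : z < 2 ^ k -> bit (z + 2 ^ k * y) (k + i) = bit y i.
Proof.
move=> lz; rewrite /bit expnD divnMA divnDr ?dvdn_mulr // mulKn ?expn_gt0 //.
by rewrite (divn_small lz).
Qed.

Lemma bit_addr k z y i : i < k -> bit (z + 2 ^ k * y) i = bit z i.
Proof.
move=> li; rewrite /bit -(subnK (ltnW li)) expnD mulnAC divnDr ?dvdn_mull //.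
rewrite mulnK ?expn_gt0 // oddD oddM oddX /= subn_eq0 leqNgt li /=.
by rewrite addbF.
Qed.

Lemma bit_small x i : x < 2 ^ i -> bit x i = false.
Proof. by move=> l; rewrite /bit divn_small. Qed.

Lemma bit_top x k : x < 2 ^ k.+1 -> bit x k = (2 ^ k <= x).
Proof.
rewrite expnS => l; case: leqP => h; last exact: bit_small.
have E : x = (x - 2 ^ k) + 2 ^ k * 1 by lia.
by rewrite E -[k in bit _ k]addn0 bit_addl //; lia.
Qed.

Lemma bit_of_bits n f i : i < n -> bit (of_bits n f) i = f i.
Proof.
move=> li; have -> : n = i + (1 + (n - i.+1)) by lia.
rewrite of_bitsD of_bitsD -[X in bit _ X]addn0 bit_addl ?of_bits_lt //.
by rewrite bit_addr // /of_bits big_ord1 muln1 addn0 /bit divn1; case: (f i).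
Qed.

Lemma bit_ge n f i : n <= i -> bit (of_bits n f) i = false.
Proof. by move=> l; rewrite bit_small // (leq_trans (of_bits_lt n f)) // leq_exp2l. Qed.

Lemma bit_half x i : bit (x %/ 2) i = bit x i.+1.
Proof. by rewrite /bit expnS divnMA. Qed.

Lemma bit_pred_exp k i : bit (2 ^ k - 1) i = (i < k).
Proof.
have -> : 2 ^ k - 1 = of_bits k (fun=> true).
  elim: k => [|k IH]; first by rewrite /of_bits big_ord0.
  rewrite -[k.+1]addn1 of_bitsD -IH {1}/of_bits big_ord1 expnD expn1 muln1.
  have : 0 < 2 ^ k by rewrite expn_gt0.
  by lia.
by case: ltnP => h; [rewrite bit_of_bits|rewrite bit_ge].
Qed.

Lemma bit_exp k i : bit (2 ^ k) i = (i == k).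
Proof.
case: (ltngtP i k) => [l|l|->].
- by have := @bit_addr k 0 1 i l; rewrite add0n muln1 => ->; rewrite /bit div0n.
- by rewrite bit_small // ltn_exp2l.
by have := @bit_addl k 0 1 0; rewrite add0n muln1 addn0 expn_gt0 => /(_ isT) ->.
Qed.

(** A matrix as a word, with the rows as digits in base 2^w. Digits may exceed the base, so
    [rows_add] needs no discussion of carries. *)
Definition rows m w (z : nat -> nat) := \sum_(r < m) z r * 2 ^ (w * r).

Lemma rowsS m w z : rows m.+1 w z = z 0 + 2 ^ w * rows m w (fun r => z r.+1).
Proof.
rewrite /rows big_ord_recl /= muln0 muln1 big_distrr /=; congr (_ + _).
by apply: eq_bigr => i _; rewrite /bump /= add1n mulnS expnD mulnCA.
Qed.

Lemma eq_rows m w z z' : (forall r, r < m -> z r = z' r) -> rows m w z = rows m w z'.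
Proof. by move=> E; apply: eq_bigr => r _; rewrite E. Qed.

Lemma rows_lt m w z : (forall r, r < m -> z r < 2 ^ w) -> rows m w z < 2 ^ (w * m).
Proof.
elim: m z => [|m IH] z H; first by rewrite /rows big_ord0 muln0.
rewrite rowsS mulnS expnD; have := H 0 isT; have := IH (fun r => z r.+1) (fun r => H r.+1).
by move: (rows _ _ _) (2 ^ w) (2 ^ (w * m)) => x y t h1 h2; nia.
Qed.

Lemma bit_rows m w z r c : (forall r, r < m -> z r < 2 ^ w) -> r < m -> c < w ->
  bit (rows m w z) (w * r + c) = bit (z r) c.
Proof.
elim: m z r => // m IH z [|r] H lr lc; rewrite rowsS.
  by rewrite muln0 bit_addr.
by rewrite mulnS -addnA bit_addl ?H // IH // => r' l'; apply: (H r'.+1).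
Qed.

Lemma of_bits_rows m w f :
  of_bits (w * m) f = rows m w (fun r => of_bits w (fun c => f (w * r + c))).
Proof.
elim: m f => [|m IH] f; first by rewrite muln0 /rows /of_bits !big_ord0.
rewrite rowsS mulnS of_bitsD IH; congr (_ + _ * _).
  by apply: eq_of_bits => i _; rewrite muln0.
by apply: eq_rows => r _; apply: eq_of_bits => c _; rewrite mulnS addnA.
Qed.

Lemma rows_const m w z : rows m w (fun=> z) = rows m w (fun=> 1) * z.
Proof. by rewrite /rows mulnC big_distrr /=; apply: eq_bigr => i _; rewrite mul1n. Qed.

Lemma rows_add m w z z' : rows m w z + rows m w z' = rows m w (fun r => z r + z' r).
Proof. by rewrite /rows -big_split /=; apply: eq_bigr => i _; rewrite mulnDl. Qed.

(** The geometric series with ratio 2^w. *)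
Lemma rows_one m w : 0 < w -> (2 ^ (w * m) - 1) %/ (2 ^ w - 1) = rows m w (fun=> 1).
Proof.
move=> w0; rewrite expnM !subn1 predn_exp mulKn.
  by apply: eq_bigr => i _; rewrite mul1n expnM.
by rewrite -subn1 subn_gt0 -{1}(expn0 2) ltn_exp2l.
Qed.

(** * The equation *)

(* With n = w^2, the word [y] is a w x w matrix with rows of w bits, and [x]  *)
(* holds w in its upper half and a set u of columns c < w - 1 in its low bits. *)
(* [RowTest] adds 2^(w-1) - 1 to each row of (u u ... u) /\ y: the top bit of  *)
(* a row becomes 1 iff u meets the row, and no carry leaves a row.             *)
Definition VarX : term 2 := Var (Ordinal (isT : 0 < 2)).
Definition VarY : term 2 := Var (Ordinal (isT : 1 < 2)).
Definition Two : term 2 := Add One One.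
(** The quotient by 2^(n/2) is the upper half of x, where the side w is guessed. *)
Definition Width : term 2 := Div VarX (Pow (Div Size Two)).
Definition TopBit : term 2 := Pow (Add Width MinusOne).
Definition LowMask : term 2 := Add TopBit MinusOne.
Definition Repunit : term 2 := Div MinusOne (Add (Pow Width) MinusOne).
Definition Columns : term 2 := Cap VarX LowMask.
Definition WidthTest : term 2 := Add (Mul Width Width) (Mul MinusOne Size).
Definition RowTest : term 2 :=
  Cap (Compl (Add (Cap (Mul Repunit Columns) VarY) (Mul Repunit LowMask))) (Mul Repunit TopBit).
Definition AdjacencyTest : term 2 := Cap Columns (Div Columns Two).
(** A maximum vanishes iff all its tests do. [Div One Size] excludes n = 1, so that n is even and x
    has two halves. *)
Definition Fterm : term 2 := Max (Div One Size) (Max WidthTest (Max RowTest AdjacencyTest)).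

Section Semantics.

Variables (d : nat) (a b : univ d).
Let n := 2 ^ d.
Let N := 2 ^ n.
Let ev (t : term 2) : nat := eval [tuple b; a] t.

Lemma ev_lt t : ev t < N. Proof. exact: ltn_ord. Qed.
Lemma ev_X : ev VarX = b. Proof. by []. Qed.
Lemma ev_Y : ev VarY = a. Proof. by []. Qed.
Lemma n_lt : n < N. Proof. exact: ltn_expl. Qed.
Lemma n_gt0 : 0 < n. Proof. by rewrite expn_gt0. Qed.
Lemma ev_One : ev One = 1.
Proof. by rewrite /ev /= modn_small // (leq_ltn_trans n_gt0 n_lt). Qed.
Lemma ev_Size : ev Size = n. Proof. by rewrite /ev /= modn_small // n_lt. Qed.
Lemma ev_MinusOne : ev MinusOne = N - 1.
Proof. by rewrite /ev /= modn_small // ltn_subrL /= expn_gt0. Qed.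
Lemma ev_Add s t : ev (Add s t) = (ev s + ev t) %% N. Proof. by []. Qed.
Lemma ev_Mul s t : ev (Mul s t) = (ev s * ev t) %% N. Proof. by []. Qed.
Lemma ev_Div s t : ev (Div s t) = ev s %/ ev t.
Proof. by rewrite /ev /= modn_small // (leq_ltn_trans (leq_div _ _)). Qed.
Lemma ev_Pow s : ev s < n -> ev (Pow s) = 2 ^ ev s.
Proof.
move=> l; rewrite /ev /= (minn_idPl _) ?modn_small ?ltn_exp2l //.
by rewrite -ltnS subn1 prednK ?expn_gt0 // ltn_exp2l.
Qed.
Lemma ev_Max0 s t : ev (Max s t) = 0 <-> ev s = 0 /\ ev t = 0.
Proof.
rewrite /ev /= modn_small; first by rewrite -/(ev s) -/(ev t); lia.
by rewrite gtn_max !ltn_ord.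
Qed.
Lemma ev_Cap s t : ev (Cap s t) = of_bits n (fun i => bit (ev s) i && bit (ev t) i).
Proof. by rewrite /ev /= modn_small // of_bits_lt. Qed.
Lemma ev_Compl s : ev (Compl s) = of_bits n (fun i => ~~ bit (ev s) i).
Proof. by rewrite /ev /= modn_small // of_bits_lt. Qed.
Lemma ev_pred t : 0 < ev t -> ev (Add t MinusOne) = ev t - 1.
Proof.
move=> h; rewrite ev_Add ev_MinusOne; have lt := ev_lt t.
have -> : ev t + (N - 1) = ev t - 1 + N by lia.
by rewrite modnDr modn_small //; lia.
Qed.

Lemma ev_DivOneSize : ev (Div One Size) = 0 <-> 0 < d.
Proof.
rewrite ev_Div ev_One ev_Size /n; case: (d) => [|e] //=; split=> // _.
by rewrite divn_small // -{1}(expn0 2) ltn_exp2l.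
Qed.

Hypothesis d_gt0 : 0 < d.
Let k := 2 ^ d.-1.
Let w := b %/ 2 ^ k.

Lemma n_double : n = 2 * k. Proof. by rewrite /n -(prednK d_gt0) expnS. Qed.
Lemma k_gt0 : 0 < k. Proof. by rewrite expn_gt0. Qed.

Lemma ev_Two : ev Two = 2.
Proof.
rewrite ev_Add ev_One modn_small //; have := n_lt; have := n_double; have := k_gt0; lia.
Qed.

Lemma ev_Width : ev Width = w.
Proof.
rewrite ev_Div ev_Pow ev_Div ev_Size ev_Two n_double mulKn //.
by have := k_gt0; lia.
Qed.

(** As half of an n-bit word, w is below 2^(n/2); hence w^2 and n are both below 2^n, and their
    congruence modulo 2^n is an equality. *)
Lemma ev_WidthTest : ev WidthTest = 0 <-> w * w = n.
Proof.
rewrite ev_Add !ev_Mul ev_Width ev_MinusOne ev_Size modnDm.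
have lw : w < 2 ^ k.
  by rewrite /w ltn_divLR ?expn_gt0 // -expnD addnn -mul2n -n_double; apply: ltn_ord.
have lww : w * w < N by rewrite /N n_double mul2n -addnn expnD; apply: ltn_mul.
have l := n_lt; have N0 : 0 < N by rewrite expn_gt0.
have E : w * w + (N - 1) * n + n = w * w + n * N.
  by rewrite mulnBl mul1n -addnA subnK ?leq_pmull // mulnC.
split=> [h|h].
  have := congr1 (fun z => (z + n) %% N) h.
  by rewrite modnDml E addnC modnMDl add0n !modn_small.
suff -> : w * w + (N - 1) * n = n * N by rewrite modnMl.
by rewrite h -{1}[n]mul1n -mulnDl; nia.
Qed.

Hypothesis ww : w * w = n.

Lemma w_gt1 : 1 < w.
Proof. have := n_double; have := k_gt0; nia. Qed.

Lemma w_lt : w < n.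
Proof. have := w_gt1; nia. Qed.

Lemma ev_TopBit : ev TopBit = 2 ^ w.-1.
Proof.
have E : ev (Add Width MinusOne) = w.-1.
  by rewrite ev_pred ev_Width ?subn1 // (ltnW w_gt1).
by rewrite ev_Pow E //; have := w_lt; have := w_gt1; lia.
Qed.

Lemma ev_LowMask : ev LowMask = 2 ^ w.-1 - 1.
Proof. by rewrite ev_pred ev_TopBit ?expn_gt0. Qed.

Let rep := rows w w (fun=> 1).

Lemma ev_Repunit : ev Repunit = rep.
Proof.
have P : ev (Pow Width) = 2 ^ w by rewrite ev_Pow ev_Width // w_lt.
by rewrite ev_Div ev_MinusOne ev_pred P ?expn_gt0 // /N -ww rows_one // ltnW // w_gt1.
Qed.

Let u := of_bits w.-1 (bit b).

Lemma ev_Columns : ev Columns = u.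
Proof.
rewrite ev_Cap ev_X ev_LowMask (@of_bits_widen w.-1).
- by apply: eq_of_bits => i li; rewrite bit_pred_exp li andbT.
- by have := w_lt; lia.
by move=> i /andP[li _]; rewrite bit_pred_exp ltnNge li andbF.
Qed.

Lemma exp_w : 2 ^ w = 2 ^ w.-1 + 2 ^ w.-1.
Proof. by rewrite -{1}(prednK (ltnW w_gt1)) expnS mul2n addnn. Qed.

Lemma ev_MulRepunit t : ev t < 2 ^ w -> ev (Mul Repunit t) = rows w w (fun=> ev t).
Proof.
move=> l; rewrite ev_Mul ev_Repunit /rep -rows_const modn_small //.
by rewrite /N -ww; apply: rows_lt.
Qed.

Lemma ev_AdjacencyTest :
  ev AdjacencyTest = 0 <-> forall c, c.+1 < w.-1 -> ~~ (bit b c && bit b c.+1).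
Proof.
rewrite ev_Cap ev_Div ev_Columns ev_Two of_bits_eq0; split=> H c lc.
  have := H c; rewrite bit_half !bit_of_bits //; last exact: ltnW.
  by apply; have := w_lt; lia.
rewrite bit_half; case: (ltnP c.+1 w.-1) => h.
  by rewrite !bit_of_bits ?H //; apply: ltnW.
by rewrite [bit u c.+1]bit_ge ?andbF.
Qed.

Let hit r := of_bits w.-1 (fun c => bit b c && bit a (w * r + c)).

(** Each row of the conjunction is a number [hit r] below 2^(w-1). Adding 2^(w-1) - 1 stays below
    2^w, so rows do not interact, and sets the top bit iff [hit r] is positive. *)
Lemma ev_RowTest :
  ev RowTest = 0 <-> forall r, r < w -> exists2 c, c < w.-1 & bit b c && bit a (w * r + c).
Proof.
have e2 := exp_w; have p1 : 0 < 2 ^ w.-1 by rewrite expn_gt0.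
have w1 := w_gt1.
have ul : u < 2 ^ w by apply: leq_trans (of_bits_lt _ _) _; lia.
have hl r : hit r < 2 ^ w.-1 by apply: of_bits_lt.
have EL : ev (Cap (Mul Repunit Columns) VarY) = rows w w hit.
  rewrite ev_Cap ev_MulRepunit ev_Columns // ev_Y -ww of_bits_rows.
  apply: eq_rows => r lr; rewrite (@of_bits_widen w.-1) ?leq_pred //.
    apply: eq_of_bits => c lc; rewrite bit_rows ?bit_of_bits //; lia.
  move=> c /andP[lc1 lc2]; rewrite bit_rows //.
  by rewrite [bit u c]bit_ge.
have EM : ev (Mul Repunit LowMask) = rows w w (fun=> 2 ^ w.-1 - 1).
  by rewrite ev_MulRepunit ev_LowMask //; lia.
have ET : ev (Mul Repunit TopBit) = rows w w (fun=> 2 ^ w.-1).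
  by rewrite ev_MulRepunit ev_TopBit //; lia.
have sl r : hit r + (2 ^ w.-1 - 1) < 2 ^ w by have := hl r; lia.
have EA : ev (Add (Cap (Mul Repunit Columns) VarY) (Mul Repunit LowMask)) =
          rows w w (fun r => hit r + (2 ^ w.-1 - 1)).
  by rewrite ev_Add EL EM rows_add modn_small // /N -ww; apply: rows_lt.
have top r : bit (hit r + (2 ^ w.-1 - 1)) w.-1 = (0 < hit r).
  by rewrite bit_top ?prednK ?(ltnW w1) //; apply/idP/idP; lia.
have tl : 2 ^ w.-1 < 2 ^ w by lia.
rewrite ev_Cap ev_Compl EA ET of_bits_eq0; split=> H.
  move=> r lr; apply/of_bits_gt0; rewrite -/(hit r) -top.
  have li : w * r + w.-1 < n by rewrite -ww; nia.
  have := H _ li; rewrite bit_of_bits // !bit_rows // ?bit_exp ?eqxx ?andbT ?negbK //; lia.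
move=> i li; rewrite bit_of_bits // (divn_eq i w) mulnC.
have lr : i %/ w < w by rewrite ltn_divLR ?ww // ltnW.
have lc : i %% w < w by rewrite ltn_mod ltnW.
rewrite !bit_rows // bit_exp negb_and negbK.
case: eqP => [->|_]; last by rewrite orbT.
by rewrite orbF top; apply/of_bits_gt0; apply: H.
Qed.

End Semantics.

Lemma Fterm_solution d (a b : univ d) : is_solution Fterm a b <->
  0 < d /\
     (let w := b %/ 2 ^ 2 ^ d.-1 in
      [/\ w * w = 2 ^ d,
          forall c, c.+1 < w.-1 -> ~~ (bit b c && bit b c.+1) &
          forall r, r < w -> exists2 c, c < w.-1 & bit b c && bit a (w * r + c)]).
Proof.
have -> : is_solution Fterm a b <-> eval [tuple b; a] Fterm = 0 :> nat.
  rewrite /is_solution; split=> [->|E]; first by rewrite /= mod0n.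
  by apply: ord_inj; rewrite E /= mod0n.
rewrite !ev_Max0 ev_DivOneSize; split.
  move=> [d0 [h1 [h2 h3]]]; have ww := (ev_WidthTest a b d0).1 h1.
  by split=> //; split=> //; [exact: (@ev_AdjacencyTest d a b d0 ww).1 h3|exact: (@ev_RowTest d a b d0 ww).1 h2].
move=> [d0 [ww h1 h2]]; split=> //; split; first exact: (ev_WidthTest a b d0).2.
by split; [exact: (@ev_RowTest d a b d0 ww).2 h2|exact: (@ev_AdjacencyTest d a b d0 ww).2 h1].
Qed.

(** * The column selection problem and its membership in NP *)

Definition selects (x : seq bool) (w : nat) (u : nat -> bool) : Prop :=
  (forall c, c.+1 < w.-1 -> ~~ (u c && u c.+1)) /\
  (forall r, r < w -> exists2 c, c < w.-1 & u c && nth false x (w * r + c)).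

Lemma solution_problemP x : solution_problem Fterm x <->
  is_pow2 (size x) /\ exists w, [/\ 1 < w, w * w = size x & exists u, selects x w u].
Proof.
split.
  move=> [d [a [-> [b /Fterm_solution[d0]]]]].
  set w := b %/ _ => -[ww h1 h2]; rewrite size_mkseq; split; first by apply/is_pow2P; exists d.
  exists w; split=> //.
    have : 2 ^ 1 <= w * w by rewrite ww leq_exp2l.
    by case: (w) => [|[|m]].
  exists (bit b); split=> // r lr; have [c lc h] := h2 r lr; exists c => //.
  by rewrite nth_mkseq // /wordsize -ww; nia.
move=> [/is_pow2P[d sx] [w [w1 ww [u [h1 h2]]]]].
have d0 : 0 < d by case: d sx => // sx; rewrite sx in ww; nia.
pose k := 2 ^ d.-1; have nk : 2 ^ d = 2 * k by rewrite -(prednK d0) expnS.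
have wk : w <= k by rewrite sx nk in ww; nia.
have wk2 : w < 2 ^ k by apply: leq_ltn_trans wk (ltn_expl _ _).
(* From w^2 = 2k and w > 1 it follows that w <= k, so the columns fit into the lower half of the
   word and w into the upper half. *)
pose bn := of_bits w.-1 u + 2 ^ k * w.
have ul : of_bits w.-1 u < 2 ^ k.
  by apply: leq_trans (of_bits_lt _ _) _; rewrite leq_exp2l //; lia.
have bl : bn < 2 ^ wordsize d.
  by rewrite /wordsize nk mul2n -addnn expnD /bn; nia.
have bw : bn %/ 2 ^ k = w.
  by rewrite /bn divnDr ?dvdn_mulr // (divn_small ul) mulKn ?expn_gt0.
have bu c : c < w.-1 -> bit bn c = u c.
  by move=> lc; rewrite bit_addr ?bit_of_bits //; lia.
pose a : univ d := Ordinal (of_bits_lt (wordsize d) (nth false x)).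
have ea i : i < size x -> bit a i = nth false x i.
  by move=> li; rewrite bit_of_bits // /wordsize -sx.
exists d, a; split.
  apply: (@eq_from_nth _ false); first by rewrite size_mkseq.
  by move=> i li; rewrite nth_mkseq ?ea // /wordsize -sx.
exists (Ordinal bl); apply/Fterm_solution; split=> //=.
rewrite -/k bw; split; first by rewrite ww.
  by move=> c lc; rewrite !bu ?h1 //; apply: ltnW.
move=> r lr; have [c lc h] := h2 r lr; exists c => //.
by rewrite bu // ea // -ww; nia.
Qed.

(** Input 0 is the instance and input 1 the column set; the square root w is found by bounded
    search. *)
Definition selection_test (X : nat -> seq bool) (r : nat -> nat) : bool :=
  is_pow2 (size (X 0)) && bex (size (X 0)).+1 (fun w =>
    [&& 1 < w, w * w == size (X 0),
        ball w (fun c => (c.+1 < w - 1) ==> ~~ (nth false (X 1) c && nth false (X 1) c.+1)) &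
        ball w (fun r => bex (w - 1) (fun c => nth false (X 1) c && nth false (X 0) (w * r + c)))]).

Lemma def_selection_test : definableb selection_test.
Proof.
rewrite /selection_test; apply: def_and; first by apply: def_is_pow2; definability.
definability.
Qed.

Lemma solution_problem_NP : NP (solution_problem Fterm).
Proof.
have [e E] := def_selection_test.
exists (fun x y => value (inputs2 x y) no_vars e != 0), 'X%R; split.
  exact: polytime_rel_value.
move=> x; rewrite solution_problemP hornerX; split.
  (* The certificate has w <= w^2 = [size x] bits, whence the bound 'X. *)
  move=> [p2 [w [w1 ww [u [h1 h2]]]]]; exists (mkseq u w); rewrite size_mkseq.
  split; first by rewrite -ww; nia.
  rewrite E eqb0 negbK /selection_test /= p2 /=; apply/bexP; exists w.
    by rewrite ltnS -[size _]ww leq_pmulr // ltnW.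
  rewrite w1 -[size _]ww eqxx /=; apply/andP; split.
    apply/ballP => c lc; apply/implyP => lc1; rewrite !nth_mkseq //; last by lia.
    by apply: h1; lia.
  apply/ballP => r lr; have [c lc h] := h2 r lr; apply/bexP; exists c; first by lia.
  by rewrite nth_mkseq //; lia.
move=> [y [_]]; rewrite E eqb0 negbK /selection_test /= => /andP[p2 /bexP[w _]].
move=> /and4P[w1 /eqP ww /ballP h1 /ballP h2]; split=> //; exists w; split=> //.
exists (nth false y); split.
  by move=> c lc; apply: (implyP (h1 c _)); lia.
by move=> r /h2/bexP[c lc h]; exists c => //; lia.
Qed.

(** * The tableau of a run *)

Section Tableau.

Variable M : machine.

Notation gam := (option (bool + aux M)).
Notation tidx := 'I_(tapes M).+1.
(** Facts are located at a time and a cell. A state is recorded at cell 0 by convention; a pair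
    gives the symbol of one tape in the cell. *)
Notation fact := (state M + tidx * gam)%type.
Notation clause :=
  (state M * {ffun tidx -> gam} * option (tidx * gam) + (option tidx + (tidx + fact)))%type.

(** Halted configurations repeat, as in [step], so the same transition clauses serve all times up to
    T. *)
Definition trans_or_stay (q : state M) (g : {ffun tidx -> gam}) : state M * (tidx -> gam * move) :=
  if halting q then (q, fun k => (g k, Stay)) else trans q g.

(** With the head fixed, a move shifts the tape: the content now in cell [i] was in cell
    [src m i]. *)
Definition src (m : move) (i : nat) : nat :=
  match m with Stay => i | MoveRight => i + 1 | MoveLeft => i - 1 end.

(* All tapes are centred at their heads, which stay at the cell [Z]. *)
Definition cell (Z : nat) (tp : tape M) (i : nat) : gam :=
  if i < Z then nth None tp.1 (Z - 1 - i) else nth None tp.2 (i - Z).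

(** Positivity of [i] keeps the i - 1 of a left move from being truncated. *)
Lemma cell_update Z tp a i : 0 < i -> cell Z (tape_update tp a) i =
  if src a.2 i == Z then a.1 else cell Z tp (src a.2 i).
Proof.
case: tp a => l r [s []] /= i0; rewrite /cell /=.
- case: (ltngtP i Z) => h.
  + have -> : (i - 1 == Z) = false by lia.
    have -> : i - 1 < Z by lia.
    by rewrite nth_behead; have -> : (Z - 1 - i).+1 = Z - 1 - (i - 1) by lia.
  + case: eqP => h1; first by have -> : i - Z = 1 by lia.
    have -> : (i - 1 < Z) = false by lia.
    have -> : i - Z = (i - 1 - Z - 1).+2 by lia.
    by rewrite /= nth_behead; have -> : (i - 1 - Z - 1).+1 = i - 1 - Z by lia.
  rewrite h subnn /=; have -> : (Z - 1 == Z) = false by lia.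
  have -> : Z - 1 < Z by lia.
  by rewrite subnn nth0.
- case: eqP => h.
    have -> : i < Z by lia.
    by have -> : Z - 1 - i = 0 by lia.
  case: (ltnP i Z) => h1.
    have -> : i + 1 < Z by lia.
    by have -> : Z - 1 - i = (Z - 1 - (i + 1)).+1 by lia.
  have -> : (i + 1 < Z) = false by lia.
  by rewrite nth_behead; have -> : (i - Z).+1 = i + 1 - Z by lia.
case: eqP => [->|h]; first by rewrite ltnn subnn.
case: ltnP => // h1; have -> : i - Z = (i - Z - 1).+1 by lia.
by rewrite /= nth_behead.
Qed.

Section Clauses.

Variables (x : seq bool) (Z T Q : nat).

Definition bit_symbol (s : gam) (v : bool) : bool :=
  (s == Some (inl true)) && v || (s == Some (inl false)) && ~~ v.

(** In the first Q cells of tape 1 either bit or a blank is allowed: there the certificate is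
    guessed. The conditions on [i] are boolean combinations so that [definability] applies. *)
Definition initial_symbol (k : tidx) (i : nat) (s : gam) : bool :=
  if k == 0 :> nat then
    ((Z <= i) && (i < Z + size x)) && bit_symbol s (nth false x (i - Z))
    || ~~ ((Z <= i) && (i < Z + size x)) && (s == None)
  else if k == 1 :> nat then
    ((Z <= i) && (i < Z + Q)) && (if s is Some (inr _) then false else true)
    || ~~ ((Z <= i) && (i < Z + Q)) && (s == None)
  else s == None.

(** Acceptance means halting with output exactly [:: true]: the head cell holds the bit 1 and the
    next cell holds no bit. *)
Definition final_error (f : fact) (i : nat) : bool :=
  match f with
  | inl q => ~~ halting q && (i == 0)
  | inr (k, s) =>
      (k == 0 :> nat) && ((i == Z) && (s != Some (inl true)) ||
                          (i == Z + 1) && (if s is Some (inl _) then true else false))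
  end.

(* The clause [e] at time [t] and cell [i]: the transition from [q] reading   *)
(* [g] yields a new state or a new symbol in the cell [i]; initial contents;  *)
(* on tape 1 a blank is followed by a blank; errors at the time [T].          *)
Definition active (e : clause) (t i : nat) : bool :=
  match e with
  | inl (q, g, None) => (t < T) && (i == 0)
  | inl (q, g, Some _) => (t < T) && ((0 < i) && (i + 1 < 2 * Z))
  | inr (inl None) => (t == 0) && (i == 0)
  | inr (inl (Some _)) => (t == 0) && (i < 2 * Z)
  | inr (inr (inl k)) => (t == 0) && ((k == 1 :> nat) && ((Z <= i) && (i + 1 < 2 * Z)))
  | inr (inr (inr f)) => (t == T) && final_error f i
  end.

Definition reads_of (f : fact) (g : {ffun tidx -> gam}) : bool :=
  if f is inr (k, s) then g k == s else false.

Definition premise (e : clause) (f : fact) (t i t' i' : nat) : bool :=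
  match e with
  | inl (q, g, o) =>
      (t' == t) && ((i' == 0) && (f == inl q) || (i' == Z) && reads_of f g ||
        (if o is Some (k, s) then (i' == src ((trans_or_stay q g).2 k).2 i) && (f == inr (k, s)) else false))
  | inr (inl _) => false
  | inr (inr (inl k)) => (t' == 0) && ((i' == i) && (f == inr (k, None)))
  | inr (inr (inr f')) => (t' == T) && ((i' == i) && (f == f'))
  end.

Definition conclusion (e : clause) (f : fact) (t i t' i' : nat) : bool :=
  match e with
  | inl (q, g, None) => (t' == t + 1) && ((i' == 0) && (f == inl (trans_or_stay q g).1))
  | inl (q, g, Some (k, s)) =>
      (t' == t + 1) && ((i' == i) &&
         ((src ((trans_or_stay q g).2 k).2 i == Z) && (f == inr (k, ((trans_or_stay q g).2 k).1)) ||
          ~~ (src ((trans_or_stay q g).2 k).2 i == Z) && (f == inr (k, s))))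
  | inr (inl None) => (t' == 0) && ((i' == 0) && (f == inl (start M)))
  | inr (inl (Some k)) =>
      (t' == 0) && ((i' == i) && (if f is inr (k', s) then (k' == k) && initial_symbol k i s else false))
  | inr (inr (inl k)) => (t' == 0) && ((i' == i + 1) && (f == inr (k, None)))
  | inr (inr (inr f')) => false
  end.

(** A clause is an implication: premises occur negatively and conclusions positively. Only the
    initial cells of the certificate offer a choice of conclusions. *)
Definition literal (e : clause) (s : bool) := (if s then conclusion else premise) e.

Definition satisfies (D : nat) (V : nat -> nat -> fact -> bool) : Prop :=
  forall e t i, t < D -> i < D -> active e t i ->
  exists s f t' i', [/\ t' < D, i' < D, literal e s f t i t' i' & V t' i' f = s].

End Clauses.

Section Run.

Variables (x y : seq bool) (Z : nat).

Definition run t : config M := iter t (@step M) (init M [:: x; y]).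

Definition read_vector (c : config M) : {ffun tidx -> gam} := [ffun k => tape_read (c.2 k)].

Lemma read_vectorE c k : read_vector c k = cell Z (c.2 k) Z.
Proof. by rewrite ffunE /cell ltnn subnn nth0. Qed.

Lemma runS t : run t.+1 = step (run t).
Proof. by []. Qed.

Lemma run_state t : (run t.+1).1 = (trans_or_stay (run t).1 (read_vector (run t))).1.
Proof.
rewrite runS /step /trans_or_stay; case: ifP => //.
by case: (trans _ _).
Qed.

Lemma run_cell t k i : 0 < i ->
  let a := (trans_or_stay (run t).1 (read_vector (run t))).2 k in
  cell Z ((run t.+1).2 k) i =
  if src a.2 i == Z then a.1 else cell Z ((run t).2 k) (src a.2 i).
Proof.
move=> i0; cbv zeta; rewrite runS /step /trans_or_stay; case: ifP => h /=.
  by case: eqP => [->|//]; rewrite read_vectorE.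
rewrite -/(read_vector (run t)); case: (trans _ _) => q a /=.
exact: cell_update.
Qed.

Lemma run_initial (k : tidx) i : cell Z ((run 0).2 k) i =
  if i < Z then None else nth None [seq Some (inl b) | b <- nth [::] [:: x; y] k] (i - Z).
Proof. by rewrite /cell /= nth_nil. Qed.

End Run.


Definition holds (Z : nat) (c : config M) (i : nat) (f : fact) : bool :=
  match f with inl q => c.1 == q | inr (k, s) => cell Z (c.2 k) i == s end.

Lemma bits_prefix_true (r : seq gam) : bits_prefix r = [:: true] <->
  nth None r 0 = Some (inl true) /\ (if nth None r 1 is Some (inl _) then false else true).
Proof.
case: r => [|[[[]|a]|] [|[[b|a']|] r]] //=; try by split=> // -[].
Qed.

Lemma final_errorP Z (c : config M) :
  (forall f i, final_error Z f i -> ~~ holds Z c i f) <->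
  halting c.1 /\ output c = [:: true].
Proof.
rewrite /output bits_prefix_true; split=> [H|[h [h0 h1]] [q|[k s]] i] /=.
- split.
    apply/negPn/negP => nh; have /= := H (inl c.1) 0.
    by rewrite nh !eqxx => /(_ isT).
  have E0 := H (inr (ord0, cell Z (c.2 ord0) Z)) Z.
  have E1 := H (inr (ord0, cell Z (c.2 ord0) (Z + 1))) (Z + 1).
  move: E0 E1; rewrite /= !eqxx /= /cell ltnn subnn (_ : Z + 1 < Z = false); last by lia.
  rewrite addKn => E0 E1; split; first by case: eqP E0 => //= _ /(_ isT).
  by case: (nth _ _ 1) E1 => [[b|]|] //=; rewrite orbT => /(_ isT).
- by case/andP => nh _; apply: contra nh => /eqP <-.
case/andP => /eqP k0; have -> : k = ord0 by apply: val_inj.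
case/orP => /andP[/eqP ->]; rewrite /cell.
  by rewrite ltnn subnn h0 eq_sym.
rewrite (_ : Z + 1 < Z = false); last by lia.
by rewrite addKn; case: s => [[b|]|] // _; case: eqP => // E; rewrite E in h1.
Qed.

(** * Satisfying assignments and accepting runs *)

Section Correctness.

Variables (x : seq bool) (Z T Q D : nat).
Hypotheses (TZ : T + 2 <= Z) (QZ : Q < Z) (ZD : 2 * Z <= D).

(** A certificate is read off the facts at time 0. The facts of its run then propagate through V,
    and the error clauses show that the run accepts; further facts true in V do no harm. *)
Lemma satisfies_run V : satisfies x Z T Q D V ->
  exists y, size y <= Q /\ (halting (run x y T).1 /\ output (run x y T) = [:: true]).
Proof.
move=> sat.
(* V may assert several symbols for one cell: the certificate stops at the first asserted blank and
   has a 1 wherever V asserts it. On a one-tape machine [inord 1] is tape 0, but then y is never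
   read. *)
pose isN j := V 0 (Z + j) (inr (inord 1, None)).
pose len := find isN (iota 0 Q).
have lenQ : len <= Q by rewrite -[Q in _ <= Q](size_iota 0) find_size.
pose y := mkseq (fun j => V 0 (Z + j) (inr (inord 1, Some (inl true)))) len.
exists y; rewrite size_mkseq; split=> //.
have ini k i : i < 2 * Z -> exists2 s, initial_symbol x Z Q k i s & V 0 i (inr (k, s)).
  move=> li; have [|||b [f [t' [i' [_ _]]]]] := sat (inr (inl (Some k))) 0 i; try lia.
    by rewrite /= li.
  case: b => //= /andP[/eqP -> /andP[/eqP ->]].
  by case: f => [//|[k' s]] /andP[/eqP -> h] vs; exists s.
have inity (k : tidx) j : k = 1 :> nat -> Z + j < 2 * Z ->
    V 0 (Z + j) (inr (k, nth None [seq Some (inl b) | b <- y] j)).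
  move=> k1; have ek : inord 1 = k by apply: val_inj; rewrite /= inordK // -k1.
  have step i : isN i -> Z + i + 1 < 2 * Z -> isN i.+1.
    rewrite /isN ek => Ni li; rewrite addnS.
    have [|||b [f [t' [i' [_ _]]]]] := sat (inr (inr (inl k))) 0 (Z + i); try lia.
      by rewrite /= k1 leq_addr li.
    case: b => /= /andP[/eqP -> /andP[/eqP -> /eqP ->]]; first by rewrite addn1.
    by rewrite Ni.
  (* If no blank is asserted in the first Q cells, the initial clause forces one at Z + Q, which is
     below 2Z because Q < Z. *)
  have Nlen : isN len.
    have [lt|ge] := ltnP len Q.
      have /(nth_find 0) : has isN (iota 0 Q) by rewrite has_find size_iota.
      by rewrite nth_iota.
    have -> : len = Q by lia.
    have [|s] := ini k (Z + Q); first by lia.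
    by rewrite /initial_symbol k1 /= ltnn andbF /= => /eqP -> ; rewrite /isN ek.
  case: (ltnP j len) => [lj li|lj].
    rewrite (nth_map false) ?size_mkseq // nth_mkseq // ek.
    have := @before_find _ 0 isN (iota 0 Q) j lj; rewrite nth_iota; last by lia.
    rewrite add0n /isN ek => nN.
    have [s] := ini k _ li; rewrite /initial_symbol k1 /= leq_addr ltn_add2l.
    rewrite (leq_trans lj lenQ) /= orbF; case: s => [[b|]|] //; last by rewrite nN.
    by case: (V 0 (Z + j) (inr (k, Some (inl true)))) / idP => h; case: b.
  rewrite nth_default; last by rewrite size_map size_mkseq.
  rewrite -ek -/(isN j).
  rewrite -(subnKC lj); elim: (j - len) => [|m IH]; first by rewrite addn0.
  by rewrite addnS => li; apply: step; [apply: IH|]; lia.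
(* No clause crosses the border, so at time t only the cells t <= i < 2Z - t are forced. *)
have inv t : t <= T -> V t 0 (inl (run x y t).1) /\
    forall k i, t <= i -> i + t < 2 * Z -> V t i (inr (k, cell Z ((run x y t).2 k) i)).
  elim: t => [|t IH] lt.
    split.
      have [|||b [f [t' [i' [_ _]]]]] := sat (inr (inl None)) 0 0; try lia; first by [].
      by case: b => //= /andP[/eqP -> /andP[/eqP -> /eqP ->]].
    move=> k i _; rewrite addn0 => li.
    have [s] := ini k i li; rewrite run_initial /initial_symbol.
    case: (k =P 0 :> nat) => [->|k0].
      case: (leqP Z i) => h /=; last by move/eqP->.
      case: (ltnP i (Z + size x)) => h1 /=; last first.
        by move/eqP->; rewrite nth_default // size_map; lia.
      rewrite orbF (nth_map false); last by lia.
      by case: nth; rewrite /bit_symbol /= ?andbF ?andbT ?orbF => /eqP ->.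
    case: (k =P 1 :> nat) => [k1|k1].
      case: (leqP Z i) => h /=; last by move/eqP->.
      move=> _ _; rewrite k1 /=; have := inity k (i - Z) k1; rewrite subnKC //; exact.
    by move=> /eqP ->; rewrite nth_default ?nth_nil ?if_same //=; case: (nat_of_ord k) k0 k1 => [|[|m]] //=; rewrite nth_nil.
  have [Hs Hc] := IH (ltnW lt).
  set q := (run x y t).1 in Hs; pose g := read_vector (run x y t).
  (* V makes these premises of the clauses for the actual state and read symbols true, so such a
     clause cannot be satisfied by negating one of them. *)
  have prem f i' : (i' == 0) && (f == inl q) || (i' == Z) && reads_of f g -> V t i' f.
    case/orP => [/andP[/eqP -> /eqP ->]|/andP[/eqP ->]] //.
    case: f => [//|[k s]] /= /eqP <-; rewrite (read_vectorE Z); apply: Hc; lia.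
  split.
    have [|||b [f [t' [i' [_ _]]]]] := sat (inl (q, g, None)) t 0; try lia.
      by rewrite /= lt.
    case: b => /= /andP[/eqP ->].
      by move=> /andP[/eqP -> /eqP ->]; rewrite run_state addn1.
    by rewrite orbF => /prem ->.
  move=> k i li1 li2; pose a := (trans_or_stay q g).2 k.
  have sl : t <= src a.2 i /\ src a.2 i + t < 2 * Z by case: (a.2) => /=; lia.
  pose s := cell Z ((run x y t).2 k) (src a.2 i).
  have [|||b [f [t' [i' [_ _]]]]] := sat (inl (q, g, Some (k, s))) t i; try lia.
    by rewrite /= lt /=; lia.
  case: b => /= /andP[/eqP ->].
    move=> /andP[/eqP -> H] vf; rewrite run_cell; last by lia.
    rewrite -/q -/g -/a -/s; rewrite -/a in H; move: H vf.
    by case: eqP => _ /=; rewrite ?orbF => /eqP ->; rewrite addn1.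
  case/orP => [/prem -> //|/andP[/eqP -> /eqP ->]].
  by rewrite Hc //; case: sl.
have [Hs Hc] := inv T (leqnn _).
apply/(final_errorP Z) => f i err.
have li : i < 2 * Z.
  by case: f err => [q|[k s]] /=; [case/andP => _ /eqP ->|case/andP => _ /orP[] /andP[/eqP -> _]]; lia.
(* The error clause makes [f] false in V, whereas facts of the run are true in V. *)
have [|||b [f' [t' [i' [_ _]]]]] := sat (inr (inr (inr f))) T i; try lia.
  by rewrite /= eqxx err.
case: b => //= /andP[/eqP -> /andP[/eqP -> /eqP ->]] nV; apply/negP => h.
case: f err h nV => [q|[k s]] /=.
  by case/andP => _ /eqP -> /eqP <-; rewrite Hs.
by move=> err /eqP <-; rewrite Hc //; case/andP: err => _ /orP[] /andP[/eqP -> _]; lia.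
Qed.

(** Under the assignment given by the run itself, each clause either has a false premise or a
    conclusion that the run validates. *)
Lemma run_satisfies y : size y <= Q ->
  halting (run x y T).1 -> output (run x y T) = [:: true] ->
  satisfies x Z T Q D (fun t i f => holds Z (run x y t) i f).
Proof.
move=> yQ hT oT e t i lt li.
have symb (s : seq bool) j : nth None [seq Some (inl b) | b <- s] j =
    (if j < size s then Some (inl (nth false s j)) else None) :> gam.
  by case: ltnP => h; [rewrite (nth_map false)|rewrite nth_default ?size_map].
case: e => [[[q g] o]|[[k|]|[k|f]]] /= act.
- have tT : t < T by case: o act => [a|] /andP[].
  have [eq|nq] := eqVneq (run x y t).1 q; last first.
    by exists false, (inl q), t, 0; split=> //=; [lia|rewrite !eqxx|apply: negbTE].
  case: (pickP (fun k => cell Z ((run x y t).2 k) Z != g k)) => [k nk|ng].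
    exists false, (inr (k, g k)), t, Z; split=> //=; [lia| |exact: negbTE].
    by rewrite !eqxx /= orbT.
  have eg : g = read_vector (run x y t).
    by apply/ffunP => k; rewrite (read_vectorE Z); apply/esym/eqP; rewrite -[_ == _]negbK ng.
  case: o act => [[k s]|] /= act; last first.
    exists true, (inl (trans_or_stay q g).1), (t + 1), 0; split=> //=; [lia|lia|by rewrite !eqxx|].
    by rewrite addn1 run_state eq -eg eqxx.
  case/andP: act => _ /andP[i0 i2].
  set a := (trans_or_stay q g).2 k.
  have sl : src a.2 i < D by case: (a.2) => /=; lia.
  have [es|ns] := eqVneq (cell Z ((run x y t).2 k) (src a.2 i)) s; last first.
    exists false, (inr (k, s)), t, (src a.2 i); split=> //=; last exact: negbTE.
    by rewrite -/a !eqxx orbT.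
  exists true, (inr (k, if src a.2 i == Z then a.1 else s)), (t + 1), i; split=> //=; first lia.
    by rewrite -/a !eqxx /=; case: (src a.2 i == Z); rewrite !eqxx.
  by rewrite addn1 run_cell // eq -eg -/a es eqxx.
- case/andP: act => /eqP -> i2.
  exists true, (inr (k, cell Z ((run x y 0).2 k) i)), 0, i; split=> //=; [lia| |by rewrite eqxx].
  rewrite !eqxx run_initial /initial_symbol symb.
  case: (leqP Z i) => h /=; last by case: eqP => // _; case: eqP.
  case: (nat_of_ord k) => [|[|m]] /=.
  + rewrite ltn_subLR //; case: ltnP => h1 //=.
    by rewrite /bit_symbol; case: nth.
  + rewrite ltn_subLR //; case: (ltnP i (Z + size y)) => h1 /=; last by case: (i < Z + Q).
    by rewrite (leq_trans h1) // leq_add2l.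
  by rewrite nth_nil.
- case/andP: act => /eqP -> /eqP ->.
  by exists true, (inl (start M)), 0, 0; split=> //=; [lia|lia|rewrite !eqxx].
- case/andP: act => /eqP -> /andP[/eqP k1 /andP[Zi i2]].
  have [e0|n0] := eqVneq (cell Z ((run x y 0).2 k) i) None; last first.
    by exists false, (inr (k, None)), 0, i; split=> //=; [lia|rewrite !eqxx|apply: negbTE].
  exists true, (inr (k, None)), 0, (i + 1); split=> //=; [lia|lia|by rewrite !eqxx|].
  move: e0; rewrite !run_initial k1 !symb /=.
  rewrite ltnNge Zi /= (_ : i + 1 < Z = false); last by lia.
  by case: ltnP => // h _; rewrite (_ : i + 1 - Z < size y = false) //; lia.
case/andP: act => /eqP -> err.
have ne := (final_errorP Z (run x y T)).2 (conj hT oT) f i err.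
exists false, f, T, i; split=> //=; [lia|by rewrite !eqxx|exact: negbTE].
Qed.

End Correctness.

End Tableau.

(** * The reduction *)

Definition fact_type (M : machine) : finType :=
  (state M + 'I_(tapes M).+1 * option (bool + aux M))%type.
Definition clause_type (M : machine) : finType :=
  (state M * {ffun 'I_(tapes M).+1 -> option (bool + aux M)} *
     option ('I_(tapes M).+1 * option (bool + aux M)) +
   (option 'I_(tapes M).+1 + ('I_(tapes M).+1 + fact_type M)))%type.

Lemma digits_inj D a b c a' b' c' : b < D -> c < D -> b' < D -> c' < D ->
  (a * D + b) * D + c = (a' * D + b') * D + c' -> [/\ a = a', b = b' & c = c'].
Proof.
move=> lb lc lb' lc' E.
have D0 : 0 < D by lia.
have E1 := congr1 (modn^~ D) E; rewrite /= !modnMDl !modn_small // in E1.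
have E2 : a * D + b = a' * D + b'.
  by have := congr1 (divn^~ D) E; rewrite /= !divnMDl // !divn_small // !addn0.
have E3 := congr1 (modn^~ D) E2; rewrite /= !modnMDl !modn_small // in E3.
by have := congr1 (divn^~ D) E2; rewrite /= !divnMDl // !divn_small // !addn0.
Qed.

Lemma digits_lt D a b c : a < D -> b < D -> c < D -> (a * D + b) * D + c < D * D * D.
Proof.
move=> la lb lc; apply: (@leq_trans ((a * D + b).+1 * D)); first by rewrite mulSn; lia.
rewrite leq_mul2r; apply/orP; right; apply: (@leq_trans (a.+1 * D)); first by rewrite mulSn; lia.
by rewrite leq_mul2r la orbT.
Qed.

Section Encoding.

Variables (M : machine) (x : seq bool) (Z T Q D : nat).

Definition fact_index t i (f : fact_type M) := (t * D + i) * D + enum_rank f.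
Definition row_index t i (e : clause_type M) := (t * D + i) * D + enum_rank e.

(* The columns 4v and 4v + 1 stand for the literals v and not v, so that the *)
(* only adjacent columns in use are complementary.                           *)
Definition column (s : bool) (v : nat) := 4 * v + ~~ s.
(** Four columns for each of D^3 facts; the row indices of clauses are below D^3 as well. If D is a
    power of 2, so is the length of the instance. *)
Definition width := 4 * (D * D * D).

Definition clause_row (r : nat) : bool :=
  bex D (fun t => bex D (fun i => fex (fun e : clause_type M =>
    (r == row_index t i e) && active Z T e t i))).

Definition literal_at (r c : nat) : bool :=
  bex D (fun t => bex D (fun i => fex (fun e : clause_type M =>
    (r == row_index t i e) && (active Z T e t i &&
    bex D (fun t' => bex D (fun i' => fex (fun f : fact_type M => fex (fun s : bool =>
      (c == column s (fact_index t' i' f)) && literal x Z T Q e s f t i t' i')))))))).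

(** A row that encodes no clause is filled with ones, so any selected column meets it. *)
Definition entry_at (r c : nat) : bool := ~~ clause_row r || literal_at r c.

(** Row and column are recovered from [j] by bounded search, as [expr] has no division. *)
Definition matrix_bit (j : nat) : bool :=
  bex width (fun r => bex width (fun c => (j == width * r + c) && entry_at r c)).

Definition instance : seq bool := mkseq matrix_bit (width * width).

Lemma nth_instance r c : r < width -> c < width ->
  nth false instance (width * r + c) = entry_at r c.
Proof.
move=> lr lc; have li : width * r + c < width * width.
  apply: (@leq_trans (width * r.+1)); first by rewrite mulnS; lia.
  by rewrite leq_mul2l lr orbT.
rewrite nth_mkseq //; apply/bexP/idP => [[r' lr' /bexP[c' lc' /andP[/eqP E h]]]|h].
  have W0 : 0 < width by lia.
  have E1 := congr1 (modn^~ width) E; rewrite /= ![width * _]mulnC !modnMDl !modn_small // in E1.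
  have E2 := congr1 (divn^~ width) E.
  rewrite /= ![width * _]mulnC !divnMDl // !divn_small // !addn0 in E2.
  by rewrite E1 E2.
by exists r => //; apply/bexP; exists c; rewrite // eqxx.
Qed.

Hypotheses (De : #|clause_type M| <= D) (Df : #|fact_type M| <= D).

Lemma rank_clause_lt (e : clause_type M) : enum_rank e < D.
Proof. exact: leq_trans (ltn_ord _) De. Qed.

Lemma rank_fact_lt (f : fact_type M) : enum_rank f < D.
Proof. exact: leq_trans (ltn_ord _) Df. Qed.

Lemma row_index_inj t i e t' i' e' : i < D -> i' < D ->
  row_index t i e = row_index t' i' e' -> [/\ t = t', i = i' & e = e'].
Proof.
move=> li li' /digits_inj[] //; try exact: rank_clause_lt.
by move=> -> -> /ord_inj/enum_rank_inj ->.
Qed.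

Lemma fact_index_inj t i f t' i' f' : i < D -> i' < D ->
  fact_index t i f = fact_index t' i' f' -> [/\ t = t', i = i' & f = f'].
Proof.
move=> li li' /digits_inj[] //; try exact: rank_fact_lt.
by move=> -> -> /ord_inj/enum_rank_inj ->.
Qed.

Lemma fact_index_lt t i f : t < D -> i < D -> fact_index t i f < D * D * D.
Proof. by move=> lt li; apply: digits_lt => //; apply: rank_fact_lt. Qed.

Lemma row_index_lt t i e : t < D -> i < D -> row_index t i e < width.
Proof.
move=> lt li; apply: (@leq_trans (D * D * D)); last by rewrite /width; lia.
by apply: digits_lt => //; apply: rank_clause_lt.
Qed.

Lemma column_lt s t i f : t < D -> i < D -> column s (fact_index t i f) < width.-1.
Proof.
move=> lt li; have := fact_index_lt f lt li; rewrite /column /width.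
by move: (D * D * D) (fact_index _ _ _) => w v; case: s => /=; lia.
Qed.

(** A fact is true iff its positive column is selected. A row met in a negative column yields a
    false fact, because the adjacent positive column cannot be selected too. *)
Lemma selects_satisfies u : selects instance width u ->
  @satisfies M x Z T Q D (fun t i f => u (column true (fact_index t i f))).
Proof.
move=> [adj hits] e t i lt li act.
have [c lc /andP[uc]] := hits _ (row_index_lt e lt li).
have lc' : c < width by lia.
rewrite nth_instance ?row_index_lt // /entry_at.
have -> /= : clause_row (row_index t i e).
  apply/bexP; exists t => //; apply/bexP; exists i => //; apply/fexP; exists e.
  by rewrite eqxx.
move=> /bexP[t1 lt1 /bexP[i1 li1 /fexP[e1 /andP[/eqP E /andP[_]]]]].
have [<- <- <-] := row_index_inj li li1 E.
move=> /bexP[t' lt' /bexP[i' li' /fexP[f /fexP[s /andP[/eqP Ec lit]]]]].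
exists s, f, t', i'; split=> //; case: s Ec {lit} => Ec; first by rewrite -Ec.
have := adj (column true (fact_index t' i' f)).
have -> : (column true (fact_index t' i' f)).+1 = c by rewrite Ec /column /=; lia.
by rewrite uc andbT => /(_ lc)/negbTE.
Qed.

Lemma satisfies_selects V : 0 < D -> @satisfies M x Z T Q D V ->
  exists u, selects instance width u.
Proof.
move=> D0 sat.
pose u c := bex D (fun t => bex D (fun i => fex (fun f : fact_type M => fex (fun s : bool =>
  (c == column s (fact_index t i f)) && (V t i f == s))))).
have uP t i f : t < D -> i < D -> u (column (V t i f) (fact_index t i f)).
  move=> lt li; apply/bexP; exists t => //; apply/bexP; exists i => //.
  by apply/fexP; exists f; apply/fexP; exists (V t i f); rewrite !eqxx.
exists u; split=> [c _|r lr].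
  apply/negP => /andP[].
  move=> /bexP[t lt /bexP[i li /fexP[f /fexP[s /andP[/eqP E /eqP h]]]]].
  move=> /bexP[t' lt' /bexP[i' li' /fexP[f' /fexP[s' /andP[/eqP E' /eqP h']]]]].
  (* Columns in use are 0 or 1 modulo 4, so two adjacent ones are the two literals of one fact. *)
  have [Ev s1 s1'] : [/\ fact_index t i f = fact_index t' i' f', s = true & s' = false].
    move: E E'; rewrite /column; case: s {h}; case: s' {h'} => /= E E'; split=> //; lia.
  have [et ei ef] := fact_index_inj li li' Ev.
  by move: h h'; rewrite et ei ef s1 s1' => ->.
case cr: (clause_row r).
  have /bexP[t lt /bexP[i li /fexP[e /andP[/eqP Er act]]]] := cr.
  have [s [f [t' [i' [lt' li' lit vs]]]]] := sat e t i lt li act.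
  exists (column s (fact_index t' i' f)); first exact: column_lt.
  have lc : column s (fact_index t' i' f) < width by have := column_lt s f lt' li'; lia.
  rewrite nth_instance // -{1}vs uP //= /entry_at cr /=.
  apply/bexP; exists t => //; apply/bexP; exists i => //; apply/fexP; exists e.
  rewrite Er eqxx act /=; apply/bexP; exists t' => //; apply/bexP; exists i' => //.
  by apply/fexP; exists f; apply/fexP; exists s; rewrite eqxx.
(* For a row of ones, the column selected for an arbitrary fact will do. *)
pose f : fact_type M := inl (start M).
have lc := column_lt (V 0 0 f) f D0 D0.
exists (column (V 0 0 f) (fact_index 0 0 f)) => //.
by rewrite nth_instance // ?uP // /entry_at ?cr //; lia.
Qed.

End Encoding.

(** * Definability of the reduction *)

Section Definability.

Variables (M : machine) (Zf Tf Qf : (nat -> seq bool) -> (nat -> nat) -> nat).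
Variables tf jf tf' jf' : (nat -> seq bool) -> (nat -> nat) -> nat.
Hypotheses (dZ : definable Zf) (dT : definable Tf) (dQ : definable Qf).
Hypotheses (dt : definable tf) (dj : definable jf) (dt' : definable tf') (dj' : definable jf').

Lemma def_src m : definable (fun X r => src m (jf X r)).
Proof. by case: m; rewrite /src; definability. Qed.

Lemma def_active (e : clause_type M) :
  definableb (fun X r => active (Zf X r) (Tf X r) e (tf X r) (jf X r)).
Proof.
by case: e => [[[q g] [a|]]|[[k|]|[k|[q|[k s]]]]]; rewrite /active /final_error; definability.
Qed.

Lemma def_premise (e : clause_type M) (f : fact_type M) :
  definableb (fun X r => premise (Zf X r) (Tf X r) e f (tf X r) (jf X r) (tf' X r) (jf' X r)).
Proof.
case: e => [[[q g] [[k s]|]]|[k|[k|f']]]; rewrite /premise; try by definability.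
have := def_src ((trans_or_stay q g).2 k).2; move: ((trans_or_stay q g).2 k).2 => m dm.
by definability.
Qed.

Lemma def_initial_symbol k (s : option (bool + aux M)) :
  definableb (fun X r => initial_symbol (X 0) (Zf X r) (Qf X r) k (jf X r) s).
Proof.
rewrite /initial_symbol /bit_symbol.
by case: (k == 0 :> nat); [|case: (k == 1 :> nat)]; definability.
Qed.

Lemma def_conclusion (e : clause_type M) (f : fact_type M) :
  definableb (fun X r =>
    conclusion (X 0) (Zf X r) (Qf X r) e f (tf X r) (jf X r) (tf' X r) (jf' X r)).
Proof.
case: e => [[[q g] [[k s]|]]|[[k|]|[k|f']]]; rewrite /conclusion; try by definability.
  have := def_src ((trans_or_stay q g).2 k).2; move: ((trans_or_stay q g).2 k).2 => m dm.
  by definability.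
case: f => [q|[k' s]]; first by definability.
have dI := def_initial_symbol k s.
by definability.
Qed.

Lemma def_literal (e : clause_type M) s (f : fact_type M) :
  definableb (fun X r =>
    literal (X 0) (Zf X r) (Tf X r) (Qf X r) e s f (tf X r) (jf X r) (tf' X r) (jf' X r)).
Proof. by case: s; [apply: def_conclusion|apply: def_premise]. Qed.

End Definability.

Section Reduction.

Variables (M : machine) (p q : {poly nat}).

Definition cert_len m : nat := q.[m]%R.
Definition time_len m : nat := p.[(m + cert_len m)%N]%R.
Definition centre m : nat := time_len m + cert_len m + 2.
(** D exceeds all times and cells of the tableau and bounds the numbers of clause and fact shapes;
    as a power of 2 it gives the instance an admissible length. *)
Definition base m : nat := next_pow2 (2 * centre m + #|clause_type M| + #|fact_type M|).

Definition reduction (x : seq bool) : seq bool :=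
  let m := size x in instance M x (centre m) (time_len m) (cert_len m) (base m).

Lemma polytime_reduction : polytime_fun reduction.
Proof.
have dm : definable (fun X r => size (X 0)) by definability.
have dQ : definable (fun X r => cert_len (size (X 0))) by apply: def_horner.
have dT : definable (fun X r => time_len (size (X 0))) by apply: def_horner; definability.
have dZ : definable (fun X r => centre (size (X 0))) by rewrite /centre; definability.
have dD : definable (fun X r => base (size (X 0))) by apply: def_next_pow2; definability.
have dw : definable (fun X r => width (base (size (X 0)))) by rewrite /width; definability.
have [eN EN] : definable (fun X r => width (base (size (X 0))) * width (base (size (X 0)))).
  by definability.
have [e E] : definableb (fun X r => matrix_bit M (X 0) (centre (size (X 0)))
    (time_len (size (X 0))) (cert_len (size (X 0))) (base (size (X 0))) (r 0)).
  rewrite /matrix_bit /entry_at /clause_row /literal_at /column /fact_index /row_index.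
  definability.
  - by apply: def_active; definability.
  - by apply: def_active; definability.
  by apply: def_literal; definability.
have := polytime_fun_value eN e; congr polytime_fun.
apply: functional_extensionality => x; rewrite EN; apply: eq_map => j.
by rewrite E eqb0 negbK.
Qed.

Variable R : seq bool -> seq bool -> bool.
Hypothesis MR : forall x y, outputs_in M [:: x; y] p.[(size x + size y)%N]%R [:: R x y].

Lemma reduction_correct x :
  (exists y, size y <= q.[size x]%R /\ R x y) <-> solution_problem Fterm (reduction x).
Proof.
set m := size x; set D := base m; set Z := centre m.
have [leD [e De]] : 2 * Z + #|clause_type M| + #|fact_type M| <= D /\ exists e, D = 2 ^ e.
  by apply: next_pow2P; rewrite /Z /centre; lia.
have D0 : 0 < D by rewrite De expn_gt0.
have TZ : time_len m + 2 <= Z by rewrite /Z /centre; lia.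
have QZ : cert_len m < Z by rewrite /Z /centre; lia.
have ZD : 2 * Z <= D by lia.
have cD : #|clause_type M| <= D by lia.
have fD : #|fact_type M| <= D by lia.
have sz : size (reduction x) = width D * width D by rewrite size_mkseq.
(* Since p is monotone, T is no earlier than the time p(|x| + |y|) by which the verifier has halted,
   and a halted configuration persists. *)
have acc y : size y <= cert_len m ->
    (halting (run M x y (time_len m)).1 /\ output (run M x y (time_len m)) = [:: true]) <-> R x y.
  move=> ly; have [h o] := MR x y.
  have -> : run M x y (time_len m) = iter p.[(size x + size y)%N]%R (@step M) (init M [:: x; y]).
    by apply: iter_halted => //; apply: horner_leq; rewrite leq_add2l.
  by rewrite o; split=> [[_ []]|->].
rewrite solution_problemP sz; split.
  move=> [y [ly Ry]]; have [hT oT] := (acc y ly).2 Ry; split.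
    by apply/is_pow2P; exists ((2 + (e + e + e)) + (2 + (e + e + e))); rewrite /width De !expnD.
  exists (width D); split=> //.
    by rewrite /width; case: (D) D0 => // k _; rewrite !mulnS; lia.
  have sat := @run_satisfies _ _ _ _ _ _ TZ QZ ZD _ ly hT oT.
  by have := satisfies_selects cD fD D0 sat.
move=> [_ [w [_ ww [u sel]]]].
have ew : w = width D by apply/eqP; rewrite -eqn_sqr -!mulnn ww.
rewrite ew in sel.
have [y [ly ho]] := satisfies_run TZ QZ ZD (@selects_satisfies _ _ _ _ _ _ cD fD _ sel).
by exists y; split=> //; apply/(acc y ly).
Qed.

End Reduction.

Theorem theorem5 : exists F : term 2, NP_complete (solution_problem F).
Proof.
exists Fterm; split; first exact: solution_problem_NP.
move=> L [R [q [[M [p MR]] HL]]].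
exists (reduction M p q); split; first exact: polytime_reduction.
by move=> x; rewrite HL; apply: reduction_correct.
Qed.
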